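(* Let $\pi$ be a pyramid. Every irreducible $W_\pi$-module is finite dimensional and is isomorphic to one of the modules $\overline L(A)$ for some $A\in\mathrm{Tab}_\pi$. Moreover $\overline L(A)\cong\overline L(B)$ if and only if $A\sim B$. Hence, fixing a set $\mathrm{Tab}_\pi/{\sim}$ of representatives for the $\sim$-equivalence classes in $\mathrm{Tab}_\pi$, the modules $\{\overline L(A)\mid A\in\mathrm{Tab}_\pi/{\sim}\}$ give a complete set of pairwise inequivalent irreducible $W_\pi$-modules.
   Context: Superalgebras are $\mathbb Z/2$-graded associative algebras over $\mathbb C$; $[x,y]=xy-(-1)^{|x||y|}yx$. Fix a parity sequence $(|1|,|2|)\in(\mathbb Z/2)^2$ with $|1|\ne|2|$. A pyramid $\pi$ is a collection of boxes in the plane in two connected rows, with $k$ boxes in the first (top) row and $l\ge k$ in the second (bottom) row, each box of the top row lying directly above a box of the bottom row. Columns are numbered $1,\dots,l$ from left to right. Row $i$ has parity $|i|$. Let $m$ (resp. $n$) be the number of boxes in the row of parity $\bar0$ (resp. $\bar1$); label the boxes of the even (resp. odd) row from left to right by $1,\dots,m$ (resp. $m+1,\dots,m+n$). Write $\mathrm{row}(i),\mathrm{col}(i)$ for the row and column of box $i$. A shift matrix is a $2\times2$ matrix $\sigma=(s_{i,j})$ of non-negative integers with $s_{1,1}=s_{2,2}=0$; it is compatible with $\pi$ if either $k>0$ and $\pi$ has $s_{2,1}$ columns of height one on its left side and $s_{1,2}$ on its right side, or $k=0$ and $l=s_{2,1}+s_{1,2}$. Fix $\sigma$ compatible with $\pi$.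 Let $\mathfrak g=\mathfrak{gl}_{m|n}(\mathbb C)$, with matrix units $e_{i,j}$ of parity $|\mathrm{row}(i)|+|\mathrm{row}(j)|$, $\bar e_{i,j}=(-1)^{|\mathrm{row}(i)|}e_{i,j}$, $(x|y)=\mathrm{str}(xy)$. Let $e=\sum e_{i,j}$ over all $(i,j)$ such that box $j$ is immediately to the right of box $i$ in the same row; $\chi(x)=(x|e)$. Grade $\mathfrak g$ by $\deg(e_{i,j})=\mathrm{col}(j)-\mathrm{col}(i)$; $\mathfrak p=\bigoplus_{r\ge0}\mathfrak g(r)$, $\mathfrak m=\bigoplus_{r<0}\mathfrak g(r)$, $\mathfrak m_\chi=\{x-\chi(x)\mid x\in\mathfrak m\}$. The principal $W$-algebra is $W_\pi=\{u\in U(\mathfrak p)\mid u\,\mathfrak m_\chi\subseteq\mathfrak m_\chi U(\mathfrak g)\}$. Write $i\prec j$ if $\mathrm{col}(i)<\mathrm{col}(j)$, or $\mathrm{col}(i)=\mathrm{col}(j)$ and $\mathrm{row}(i)<\mathrm{row}(j)$. Let $\tilde\rho(e_{j,j})=(-1)^{|\mathrm{row}(j)|}\big(\#\{i\mid i\preceq j,|\mathrm{row}(i)|=\bar1\}-\#\{i\mid i\prec j,|\mathrm{row}(i)|=\bar0\}\big)$ and let $S_{\tilde\rho}$ be the automorphism $e_{i,j}\mapsto e_{i,j}+\delta_{i,j}\tilde\rho(e_{i,i})$ of $U(\mathfrak p)$. For $1\le i,j\le2$, $0\le\varsigma\le2$, $r\ge1$, $$t_{i,j;\varsigma}^{(r)}=S_{\tilde\rho}\Big(\sum_{s=1}^r(-1)^{r-s}\sum(-1)^{\#\{a=1,\dots,s-1\mid\mathrm{row}(j_a)\le\varsigma\}}\bar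 e_{i_1,j_1}\cdots\bar e_{i_s,j_s}\Big),$$ the inner sum over all $1\le i_1,\dots,i_s,j_1,\dots,j_s\le m+n$ such that: $\mathrm{row}(i_1)=i$, $\mathrm{row}(j_s)=j$; $\mathrm{col}(i_a)\le\mathrm{col}(j_a)$ for $1\le a\le s$; and for $1\le a\le s-1$: $\mathrm{row}(i_{a+1})=\mathrm{row}(j_a)$, $\mathrm{col}(i_{a+1})>\mathrm{col}(j_a)$ if $\mathrm{row}(j_a)>\varsigma$, $\mathrm{col}(i_{a+1})\le\mathrm{col}(j_a)$ if $\mathrm{row}(j_a)\le\varsigma$; and $\sum_a\deg(e_{i_a,j_a})=r-s$. Drinfeld generators of $W_\pi$: $d_1^{(r)}=t_{1,1;0}^{(r)}$, $d_2^{(r)}=t_{2,2;1}^{(r)}$ ($r>0$), $e^{(r)}=t_{1,2;1}^{(r)}$ ($r>s_{1,2}$), $f^{(r)}=t_{2,1;1}^{(r)}$ ($r>s_{2,1}$). Established fact fixing the setup: these elements lie in $W_\pi$ and identify $W_\pi$ with the superalgebra generated by even $d_1^{(r)},d_2^{(r)}$ ($r>0$) and odd $e^{(r)}$ ($r>s_{1,2}$), $f^{(r)}$ ($r>s_{2,1}$) subject only to $d_1^{(r)}=0$ for $r>k$ and $$[d_i^{(r)},d_j^{(s)}]=[e^{(r)},e^{(s)}]=[f^{(r)},f^{(s)}]=0,\quad[e^{(r)},f^{(s)}]=(-1)^{|1|}\sum_{a=0}^{r+s-1}\tilde d_1^{(a)}d_2^{(r+s-1-a)},$$ $$[d_i^{(r)},e^{(s)}]=(-1)^{|1|}\sum_{a=0}^{r-1}d_i^{(a)}e^{(r+s-1-a)},\quad[d_i^{(r)},f^{(s)}]=-(-1)^{|1|}\sum_{a=0}^{r-1}f^{(r+s-1-a)}d_i^{(a)},$$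 with $d_i^{(0)}=1$ and $\sum_{a=0}^r\tilde d_i^{(a)}d_i^{(r-a)}=\delta_{r,0}$. $W_\pi^0$ is the subalgebra generated by $d_1^{(r)}$ ($0<r\le k$), $d_2^{(s)}$ ($0<s\le l$), which is the polynomial algebra on these generators. $W_\pi^\sharp$ is the subalgebra generated by $W_\pi^0$ and $e^{(r)}$ ($s_{1,2}<r\le s_{1,2}+k$); it contains all $e^{(r)}$, $r>s_{1,2}$, and there is a unique surjection $W_\pi^\sharp\twoheadrightarrow W_\pi^0$ that is the identity on $W_\pi^0$ and kills all $e^{(r)}$ ($r>s_{1,2}$). A $\pi$-tableau is a filling of the boxes of $\pi$ by complex numbers; $\mathrm{Tab}_\pi$ is the set of all $\pi$-tableaux. The tableau with entries $a_1,\dots,a_k$ along its first row and $b_1,\dots,b_l$ along its second row is written $\substack{a_1\cdots a_k\\ b_1\cdots b_l}$. $A\sim B$ (row equivalent) means $B$ is obtained from $A$ by permuting entries within each row. For $A=\substack{a_1\cdots a_k\\ b_1\cdots b_l}$, $\mathbb C_A$ is the one-dimensional $W_\pi^0$-module with basis $1_A$ on which $d_1^{(r)}$ ($0<r\le k$) acts as $e_r(a_1,\dots,a_k)$ and $d_2^{(r)}$ ($0<r\le l$) acts as $e_r(b_1,\dots,b_l)$ ($e_r$ = $r$th elementary symmetric polynomial); view it as a $W_\pi^\sharp$-module via $W_\pi^\sharp\twoheadrightarrow W_\pi^0$. The Verma module is $\overline M(A)=W_\pi\otimes_{W_\pi^\sharp}\mathbb C_A$, and $\overline L(A)$ is its unique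 irreducible quotient (which exists). *)

(* Defs.v *)
From HB Require Import structures.
From mathcomp Require Import all_boot all_order all_algebra.
From mathcomp Require Import generic_quotient ring_quotient boolp classical_sets.
From mathcomp Require Import reals.
From mathcomp Require Export complex.

Set Implicit Arguments.
Unset Strict Implicit.
Unset Printing Implicit Defensive.

Import GRing.Theory.

Local Open Scope ring_scope.
Local Open Scope quotient_scope.

Inductive gen_subalg (K : fieldType) (A : algType K) (G : A -> Prop) :
    A -> Prop :=
  | gen_in x : G x -> gen_subalg G x
  | gen_scal c : gen_subalg G c%:A
  | gen_add x y : gen_subalg G x -> gen_subalg G y -> gen_subalg G (x + y)
  | gen_mul x y : gen_subalg G x -> gen_subalg G y -> gen_subalg G (x * y).

(* [f] restricts to a unital algebra homomorphism on the subalgebra [S];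
   its values outside [S] are irrelevant. *)
Definition alg_hom_on (K : fieldType) (A B : algType K) (S : A -> Prop)
    (f : A -> B) : Prop :=
  f 1 = 1 /\
  forall x y, S x -> S y ->
    f (x * y) = f x * f y /\ forall a, f (a *: x + y) = a *: f x + f y.

Record submodule (W : pzRingType) (V : lmodType W) := Submodule {
  submod_pred : V -> bool;
  submod_predP : submod_closed (submod_pred : {pred V})
}.

Lemma submodule_zmod_closed (W : pzRingType) (V : lmodType W)
  (N : submodule V) : zmod_closed (submod_pred N : {pred V}).
Proof.
case: (submod_predP N) => N0 Nlin; split=> // u v Nu Nv.
by rewrite -[u - v]addrC -scaleN1r Nlin.
Qed.

HB.instance Definition _ (W : pzRingType) (V : lmodType W) (N : submodule V) :=
  GRing.isZmodClosed.Build V (submod_pred N) (submodule_zmod_closed N).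

HB.instance Definition _ (W : pzRingType) (V : lmodType W) :=
  gen_eqMixin (submodule V).
HB.instance Definition _ (W : pzRingType) (V : lmodType W) :=
  gen_choiceMixin (submodule V).

Definition submod_zmod (W : pzRingType) (V : lmodType W) (N : submodule V) :
  zmodClosed V := GRing.ZmodClosed.clone V (submod_pred N) _.

Definition quot_mod (W : pzRingType) (V : lmodType W) (N : submodule V) : Type :=
  @Quotient.quot V (submod_zmod N).

HB.instance Definition _ (W : pzRingType) (V : lmodType W) (N : submodule V) :=
  GRing.Zmodule.on (quot_mod N).

Section QuotientModule.
Variables (W : pzRingType) (V : lmodType W) (N : submodule V).

Definition quot_proj (v : V) : quot_mod N :=
  \pi_(@Quotient.quot V (submod_zmod N)) v.

Lemma quot_projE u v : quot_proj u = quot_proj v <-> submod_pred N (u - v).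
Proof.
by split=> [/eqP|uv]; [|apply/eqP]; rewrite /quot_proj -Quotient.idealrBE.
Qed.

Lemma quot_proj_surj (x : quot_mod N) : exists v, x = quot_proj v.
Proof. by exists (repr (x : @Quotient.quot V (submod_zmod N))); rewrite /quot_proj reprK. Qed.

Lemma quot_projD u v : quot_proj (u + v) = quot_proj u + quot_proj v.
Proof. by rewrite /quot_proj; exact: raddfD. Qed.

Definition quot_scale (a : W) (x : quot_mod N) : quot_mod N :=
  quot_proj (a *: repr (x : @Quotient.quot V (submod_zmod N))).

Lemma quot_scaleE a v : quot_scale a (quot_proj v) = quot_proj (a *: v).
Proof.
apply/quot_projE; rewrite -scalerBr.
case: (submod_predP N) => N0 Nlin.
rewrite -[_ *: _]addr0; apply: Nlin => //; apply/quot_projE.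
by rewrite /quot_proj reprK.
Qed.

Lemma quot_scaleA a b x : quot_scale a (quot_scale b x) = quot_scale (a * b) x.
Proof. by have [v ->] := quot_proj_surj x; rewrite !quot_scaleE scalerA. Qed.

Lemma quot_scale1 : left_id 1 quot_scale.
Proof. by move=> x; have [v ->] := quot_proj_surj x; rewrite quot_scaleE scale1r. Qed.

Lemma quot_scaleDr : right_distributive quot_scale +%R.
Proof.
move=> a x y; have [u ->] := quot_proj_surj x; have [v ->] := quot_proj_surj y.
by rewrite -quot_projD !quot_scaleE scalerDr quot_projD.
Qed.

Lemma quot_scaleDl v : {morph quot_scale^~ v : a b / a + b}.
Proof.
move=> a b; have [u ->] := quot_proj_surj v.
by rewrite !quot_scaleE scalerDl quot_projD.
Qed.

HB.instance Definition _ := GRing.Zmodule_isLmodule.Build W (quot_mod N)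
  quot_scaleA quot_scale1 quot_scaleDr quot_scaleDl.

End QuotientModule.

Inductive gen_submod (W : pzRingType) (V : lmodType W) (G : V -> Prop) :
    V -> Prop :=
  | gens_0 : gen_submod G 0
  | gens_D a u v : G u -> gen_submod G v -> gen_submod G (a *: u + v).

Lemma gen_submod_closed (W : pzRingType) (V : lmodType W) (G : V -> Prop) :
  submod_closed ((fun v => `[< gen_submod G v >]) : {pred V}).
Proof.
split=> [|a u v]; first exact/asboolP/gens_0.
move=> /asboolP Gu /asboolP Gv; apply/asboolP.
elim: Gu => [|b w u' Gw _ IH]; first by rewrite scaler0 add0r.
by rewrite scalerDr scalerA -addrA; apply: gens_D.
Qed.

Definition submod_span (W : pzRingType) (V : lmodType W) (G : V -> Prop) :
  submodule V := Submodule (gen_submod_closed G).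

Definition irreducible_mod (W : pzRingType) (V : lmodType W) : Prop :=
  (exists v : V, v != 0) /\
  forall N : submodule V,
    (forall v, submod_pred N v -> v = 0) \/ (forall v, submod_pred N v).

Definition iso_mod (W : pzRingType) (V V' : lmodType W) : Prop :=
  exists f : {linear V -> V'}, bijective f.

(* The base field acts on a [W]-module through the scalars [c%:A] of [W]. *)
Definition finite_dim_mod (K : fieldType) (W : algType K) (V : lmodType W) :
    Prop :=
  exists n (b : 'I_n -> V), forall v, exists c : 'I_n -> K,
    v = \sum_(i < n) (c i)%:A *: b i.

Section Enveloping.
Variables (K : fieldType) (N : nat) (par : 'I_N -> bool).

Definition gl_homogeneous (b : bool) (x : 'M[K]_N) : Prop :=
  forall i j, x i j != 0 -> par i (+) par j = b.

Inductive tterm : Type :=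
  | Tvar of 'M[K]_N
  | Tscal of K
  | Tadd of tterm & tterm
  | Tmul of tterm & tterm.

(* The congruence generated by the axioms of associative unital algebras, by
   linearity of [Tvar] and by [x,y] = xy - (-1)^(|x||y|) yx. *)
Inductive tcongr : tterm -> tterm -> Prop :=
  | tc_refl t : tcongr t t
  | tc_sym t u : tcongr t u -> tcongr u t
  | tc_trans t u v : tcongr t u -> tcongr u v -> tcongr t v
  | tc_add t t' u u' : tcongr t t' -> tcongr u u' ->
      tcongr (Tadd t u) (Tadd t' u')
  | tc_mul t t' u u' : tcongr t t' -> tcongr u u' ->
      tcongr (Tmul t u) (Tmul t' u')
  | tc_addA t u v : tcongr (Tadd t (Tadd u v)) (Tadd (Tadd t u) v)
  | tc_addC t u : tcongr (Tadd t u) (Tadd u t)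
  | tc_add0 t : tcongr (Tadd (Tscal 0) t) t
  | tc_addN t : tcongr (Tadd (Tmul (Tscal (-1)) t) t) (Tscal 0)
  | tc_mulA t u v : tcongr (Tmul t (Tmul u v)) (Tmul (Tmul t u) v)
  | tc_mul1 t : tcongr (Tmul (Tscal 1) t) t
  | tc_mulDl t u v : tcongr (Tmul (Tadd t u) v) (Tadd (Tmul t v) (Tmul u v))
  | tc_mulDr t u v : tcongr (Tmul t (Tadd u v)) (Tadd (Tmul t u) (Tmul t v))
  | tc_scalD a b : tcongr (Tscal (a + b)) (Tadd (Tscal a) (Tscal b))
  | tc_scalM a b : tcongr (Tscal (a * b)) (Tmul (Tscal a) (Tscal b))
  | tc_scalC a t : tcongr (Tmul (Tscal a) t) (Tmul t (Tscal a))
  | tc_lin a x y :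
      tcongr (Tvar (a *: x + y)) (Tadd (Tmul (Tscal a) (Tvar x)) (Tvar y))
  | tc_bracket b c x y : gl_homogeneous b x -> gl_homogeneous c y ->
      tcongr (Tvar (x *m y - (-1) ^+ (b && c) *: (y *m x)))
        (Tadd (Tmul (Tvar x) (Tvar y))
              (Tmul (Tscal (- (-1) ^+ (b && c))) (Tmul (Tvar y) (Tvar x)))).

HB.instance Definition _ := gen_eqMixin tterm.
HB.instance Definition _ := gen_choiceMixin tterm.

Definition tequiv (t u : tterm) : bool := `[< tcongr t u >].

Lemma tequiv_is_equiv : equiv_class_of tequiv.
Proof.
split=> [t|t u|u t v]; first exact/asboolP/tc_refl.
  by apply/asboolP/asboolP; apply: tc_sym.
by move=> /asboolP tu /asboolP uv; apply/asboolP; apply: tc_trans tu uv.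
Qed.

Canonical tequiv_equiv := EquivRelPack tequiv_is_equiv.
Canonical tequiv_encModRel := defaultEncModRel tequiv.

Definition envalg : Type := {eq_quot tequiv}.
HB.instance Definition _ := Choice.on envalg.

Definition tclass (t : tterm) : envalg := \pi_({eq_quot tequiv}) t.

Lemma tclassE t u : tclass t = tclass u <-> tcongr t u.
Proof.
split=> [/eqP|tu]; first by rewrite /tclass eqmodE => /asboolP.
by apply/eqP; rewrite /tclass eqmodE; apply/asboolP.
Qed.

Lemma tclass_surj (x : envalg) : exists t, x = tclass t.
Proof. by exists (repr (x : {eq_quot tequiv})); rewrite /tclass reprK. Qed.

Definition trepr (x : envalg) : tterm := repr (x : {eq_quot tequiv}).

Lemma trepr_class t : tcongr (trepr (tclass t)) t.
Proof. by apply/tclassE; rewrite /tclass /trepr reprK. Qed.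

Definition env_add (x y : envalg) := tclass (Tadd (trepr x) (trepr y)).
Definition env_mul (x y : envalg) := tclass (Tmul (trepr x) (trepr y)).
Definition env_opp (x : envalg) := tclass (Tmul (Tscal (-1)) (trepr x)).
Definition env_scale (a : K) (x : envalg) := tclass (Tmul (Tscal a) (trepr x)).

Lemma env_addE t u : env_add (tclass t) (tclass u) = tclass (Tadd t u).
Proof. by apply/tclassE/tc_add; apply: trepr_class. Qed.
Lemma env_mulE t u : env_mul (tclass t) (tclass u) = tclass (Tmul t u).
Proof. by apply/tclassE/tc_mul; apply: trepr_class. Qed.
Lemma env_oppE t : env_opp (tclass t) = tclass (Tmul (Tscal (-1)) t).
Proof. by apply/tclassE/tc_mul; [apply: tc_refl|apply: trepr_class]. Qed.
Lemma env_scaleE a t : env_scale a (tclass t) = tclass (Tmul (Tscal a) t).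
Proof. by apply/tclassE/tc_mul; [apply: tc_refl|apply: trepr_class]. Qed.

Let tE := (env_addE, env_mulE, env_oppE, env_scaleE).

Lemma env_addA : associative env_add.
Proof.
move=> x y z; have [t ->] := tclass_surj x; have [u ->] := tclass_surj y.
by have [v ->] := tclass_surj z; rewrite !tE; apply/tclassE/tc_addA.
Qed.
Lemma env_addC : commutative env_add.
Proof.
move=> x y; have [t ->] := tclass_surj x; have [u ->] := tclass_surj y.
by rewrite !tE; apply/tclassE/tc_addC.
Qed.
Lemma env_add0 : left_id (tclass (Tscal 0)) env_add.
Proof. by move=> x; have [t ->] := tclass_surj x; rewrite !tE; apply/tclassE/tc_add0. Qed.
Lemma env_addN : left_inverse (tclass (Tscal 0)) env_opp env_add.
Proof. by move=> x; have [t ->] := tclass_surj x; rewrite !tE; apply/tclassE/tc_addN. Qed.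

HB.instance Definition _ := GRing.isZmodule.Build envalg
  env_addA env_addC env_add0 env_addN.

Lemma env_mulA : associative env_mul.
Proof.
move=> x y z; have [t ->] := tclass_surj x; have [u ->] := tclass_surj y.
by have [v ->] := tclass_surj z; rewrite !tE; apply/tclassE/tc_mulA.
Qed.
Lemma env_mul1 : left_id (tclass (Tscal 1)) env_mul.
Proof. by move=> x; have [t ->] := tclass_surj x; rewrite !tE; apply/tclassE/tc_mul1. Qed.
Lemma env_mulr1 : right_id (tclass (Tscal 1)) env_mul.
Proof.
move=> x; have [t ->] := tclass_surj x; rewrite !tE; apply/tclassE.
exact: tc_trans (tc_sym (tc_scalC 1 t)) (tc_mul1 t).
Qed.
Lemma env_mulDl : left_distributive env_mul +%R.
Proof.
move=> x y z; have [t ->] := tclass_surj x; have [u ->] := tclass_surj y.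
by have [v ->] := tclass_surj z; rewrite /GRing.add /= !tE; apply/tclassE/tc_mulDl.
Qed.
Lemma env_mulDr : right_distributive env_mul +%R.
Proof.
move=> x y z; have [t ->] := tclass_surj x; have [u ->] := tclass_surj y.
by have [v ->] := tclass_surj z; rewrite /GRing.add /= !tE; apply/tclassE/tc_mulDr.
Qed.

(* The augmentation [Tvar x |-> 0], needed for [1 != 0]. *)
Fixpoint taug (t : tterm) : K :=
  match t with
  | Tvar _ => 0
  | Tscal a => a
  | Tadd t u => taug t + taug u
  | Tmul t u => taug t * taug u
  end.

Lemma taug_congr t u : tcongr t u -> taug t = taug u.
Proof.
elim=> //= {t u}.
- by move=> t u v _ -> _ ->.
- by move=> t t' u u' _ -> _ ->.
- by move=> t t' u u' _ -> _ ->.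
- by move=> *; rewrite addrA.
- by move=> *; rewrite addrC.
- by move=> *; rewrite add0r.
- by move=> *; rewrite mulN1r addNr.
- by move=> *; rewrite mulrA.
- by move=> *; rewrite mul1r.
- by move=> *; rewrite mulrDl.
- by move=> *; rewrite mulrDr.
- by move=> *; rewrite mulrC.
- by move=> *; rewrite mulr0 addr0.
- by move=> *; rewrite !mulr0 addr0.
Qed.

Lemma env_one_neq0 : tclass (Tscal 1) != 0.
Proof. by apply/eqP => /tclassE/taug_congr/eqP; rewrite oner_eq0. Qed.

HB.instance Definition _ := GRing.Zmodule_isNzRing.Build envalg
  env_mulA env_mul1 env_mulr1 env_mulDl env_mulDr env_one_neq0.

Lemma env_scaleA a b x : env_scale a (env_scale b x) = env_scale (a * b) x.
Proof.
have [t ->] := tclass_surj x; rewrite !tE; apply/tclassE.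
apply: tc_trans (tc_mulA _ _ _) _.
by apply: tc_mul (tc_refl t); apply: tc_sym; apply: tc_scalM.
Qed.
Lemma env_scale1 : left_id 1 env_scale.
Proof. by move=> x; have [t ->] := tclass_surj x; rewrite !tE; apply/tclassE/tc_mul1. Qed.
Lemma env_scaleDr : right_distributive env_scale +%R.
Proof.
move=> a x y; have [t ->] := tclass_surj x; have [u ->] := tclass_surj y.
by rewrite /GRing.add /= !tE; apply/tclassE/tc_mulDr.
Qed.
Lemma env_scaleDl x : {morph env_scale^~ x : a b / a + b}.
Proof.
move=> a b; have [t ->] := tclass_surj x; rewrite [in RHS]/GRing.add /= !tE.
apply/tclassE; apply: tc_trans (tc_mulDl _ _ _).
exact: tc_mul (tc_scalD _ _) (tc_refl t).
Qed.

HB.instance Definition _ := GRing.Zmodule_isLmodule.Build K envalg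
  env_scaleA env_scale1 env_scaleDr env_scaleDl.

Lemma env_scaleAl (a : K) (x y : envalg) : a *: (x * y) = a *: x * y.
Proof.
have [t ->] := tclass_surj x; have [u ->] := tclass_surj y.
by rewrite /GRing.scale /GRing.mul /= !tE; apply/tclassE/tc_mulA.
Qed.
HB.instance Definition _ := GRing.Lmodule_isLalgebra.Build K envalg env_scaleAl.

Lemma env_scaleAr (a : K) (x y : envalg) : a *: (x * y) = x * (a *: y).
Proof.
have [t ->] := tclass_surj x; have [u ->] := tclass_surj y.
rewrite /GRing.scale /GRing.mul /= !tE; apply/tclassE.
apply: tc_trans (tc_mulA _ _ _) _; apply: tc_trans (tc_sym (tc_mulA _ _ _)).
exact: tc_mul (tc_scalC _ _) (tc_refl u).
Qed.
HB.instance Definition _ := GRing.Lalgebra_isAlgebra.Build K envalg env_scaleAr.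

Definition env_iota (x : 'M[K]_N) : envalg := tclass (Tvar x).

End Enveloping.

(* The first (top) row occupies the columns [pyr_off + 1 .. pyr_off + pyr_k],
   the second (bottom) row the columns [1 .. pyr_l]. If [pyr_k = 0] the value of
   [pyr_off] plays no role. *)
Record pyramid := Pyramid {
  pyr_k : nat;
  pyr_l : nat;
  pyr_off : nat;
  pyr_le : (pyr_off + pyr_k <= pyr_l)%N
}.

Definition top_row : 'I_2 := ord0.
Definition bot_row : 'I_2 := ord_max.

Definition compatible (pi : pyramid) (sigma : 'M[nat]_2) : Prop :=
  sigma top_row top_row = 0%N /\ sigma bot_row bot_row = 0%N /\
  if (0 < pyr_k pi)%N then
    sigma bot_row top_row = pyr_off pi /\
    sigma top_row bot_row = (pyr_l pi - (pyr_off pi + pyr_k pi))%N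
  else pyr_l pi = (sigma bot_row top_row + sigma top_row bot_row)%N.

Section PrincipalW.
Variables (K : fieldType) (pi : pyramid) (p : 'I_2 -> bool).

Definition row_len (i : 'I_2) : nat := if i == top_row then pyr_k pi else pyr_l pi.

Definition even_row : 'I_2 := if p top_row then bot_row else top_row.
Definition odd_row : 'I_2 := if p top_row then top_row else bot_row.

Definition num_even : nat := row_len even_row.
Definition num_odd : nat := row_len odd_row.

(* The box labelled [i + 1] is represented by [i : 'I_(m + n)]. *)
Definition box : Type := 'I_(num_even + num_odd).
HB.instance Definition _ := Finite.on box.

Definition row_of (b : box) : 'I_2 :=
  if (b < num_even)%N then even_row else odd_row.

Definition col_of (b : box) : nat :=
  ((if (b < num_even)%N then b : nat else (b - num_even)%N)
   + (if row_of b == top_row then pyr_off pi else 0)).+1%N.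

Definition par (b : box) : bool := p (row_of b).

Local Notation gl := 'M[K]_(num_even + num_odd).

Definition Ug : Type := envalg K par.
HB.instance Definition _ := GRing.Algebra.on Ug.

Definition iota_g (x : gl) : Ug := env_iota par x.

Definition bdeg (i j : box) : int := (col_of j)%:Z - (col_of i)%:Z.

Definition str (x : gl) : K := \sum_(i : box) (-1) ^+ par i * x i i.

Definition nilp : gl :=
  \matrix_(i, j) ((row_of i == row_of j) && (col_of j == (col_of i).+1))%:R.

Definition chi (x : gl) : K := str (x *m nilp).

Definition in_p (x : gl) : Prop := forall i j, x i j != 0 -> 0 <= bdeg i j.
Definition in_m (x : gl) : Prop := forall i j, x i j != 0 -> bdeg i j < 0.

(* By the PBW theorem, U(p) is the subalgebra of U(g) generated by p. *)
Definition in_Up : Ug -> Prop :=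
  gen_subalg (fun u => exists2 x, in_p x & u = iota_g x).

Inductive in_mchiU : Ug -> Prop :=
  | mchi_0 : in_mchiU 0
  | mchi_D x u v : in_m x -> in_mchiU v ->
      in_mchiU ((iota_g x - (chi x)%:A) * u + v).

Definition in_W (u : Ug) : Prop :=
  in_Up u /\ forall x, in_m x -> in_mchiU (u * (iota_g x - (chi x)%:A)).

Definition in_Wb (u : Ug) : bool := `[< in_W u >].

Lemma in_mchiU_add u v : in_mchiU u -> in_mchiU v -> in_mchiU (u + v).
Proof.
by elim=> [|x w u' mx _ IH] mv; rewrite ?add0r // -addrA; apply: mchi_D; auto.
Qed.

Lemma in_mchiU_mulr u v : in_mchiU u -> in_mchiU (u * v).
Proof.
elim=> [|x w u' mx _ IH]; first by rewrite mul0r; apply: mchi_0.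
by rewrite mulrDl -mulrA; apply: mchi_D.
Qed.

Lemma in_mchiU_scale a u : in_mchiU u -> in_mchiU (a *: u).
Proof. by move=> mu; rewrite -mulr_algr; apply: in_mchiU_mulr. Qed.

Lemma in_Wb_subalg_closed : subalg_closed (in_Wb : {pred Ug}).
Proof.
split=> [|a u v|u v].
- apply/asboolP; split=> [|x mx].
    by rewrite -(scale1r (1 : Ug)); apply: gen_scal.
  by rewrite mul1r -[_ - _]mulr1 -[_ * 1]addr0; apply: mchi_D mchi_0.
- move=> /asboolP[pu mu] /asboolP[pv mv]; apply/asboolP; split=> [|x mx].
    by rewrite -mulr_algl; apply: gen_add pv; apply: gen_mul pu; apply: gen_scal.
  rewrite mulrDl -scalerAl; apply: in_mchiU_add (mv x mx).
  exact: in_mchiU_scale (mu x mx).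
- move=> /asboolP[pu mu] /asboolP[pv mv]; apply/asboolP; split=> [|x mx].
    exact: gen_mul.
  rewrite -mulrA; elim: (mv x mx) => [|y w v' my _ IH].
    by rewrite mulr0; apply: mchi_0.
  by rewrite mulrDr mulrA; apply: in_mchiU_add IH; apply: in_mchiU_mulr (mu y my).
Qed.

HB.instance Definition _ := GRing.isSubalgClosed.Build K Ug in_Wb
  in_Wb_subalg_closed.

Record Walg := MkWalg { Wval : Ug; Wprop : in_Wb Wval }.
HB.instance Definition _ := [isSub for Wval].
HB.instance Definition _ := [Choice of Walg by <:].
HB.instance Definition _ := [SubChoice_isSubAlgebra of Walg by <:].

Definition bprec (i j : box) : bool :=
  (col_of i < col_of j)%N
  || (col_of i == col_of j) && (row_of i < row_of j)%N.

Definition rho (j : box) : K :=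
  (-1) ^+ par j *
  (#|[set i | (bprec i j || (i == j)) && par i]|%:R
   - #|[set i | bprec i j && ~~ par i]|%:R).

(* The image of [(-1)^|row(i)| e_{i,j}] under the algebra automorphism
   S_rho of U(p). *)
Definition Sebar (i j : box) : Ug :=
  (-1) ^+ par i *: (iota_g (delta_mx i j) + ((i == j)%:R * rho i)%:A).

(* The index condition on (i_1, .., i_{q+1}; j_1, .., j_{q+1}). As rows are
   numbered from 0 here, "row(j_a) <= varsigma" reads [row_of (J a) < vs]. *)
Definition t_index (i j : 'I_2) (vs r q : nat) (I J : 'I_q.+1 -> box) : bool :=
  [&& row_of (I ord0) == i,
      row_of (J ord_max) == j,
      [forall a, (col_of (I a) <= col_of (J a))%N],
      [forall a : 'I_q,
         let ja := J (widen_ord (leqnSn q) a) in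
         let ia1 := I (lift ord0 a) in
         (row_of ia1 == row_of ja) &&
         (if (row_of ja < vs)%N then (col_of ia1 <= col_of ja)%N
          else (col_of ja < col_of ia1)%N)]
    & \sum_a bdeg (I a) (J a) == r%:Z - q.+1%:Z].

(* This is t_{i,j;vs}^{(r)}; the summation index [q] is s - 1. The automorphism S_rho
   has been applied factor by factor. *)
Definition t_elt (i j : 'I_2) (vs r : nat) : Ug :=
  \sum_(q < r) (-1) ^+ (r - q.+1) *:
    \sum_(IJ : {ffun 'I_q.+1 -> box} * {ffun 'I_q.+1 -> box}
          | t_index i j vs r IJ.1 IJ.2)
      (-1) ^+ #|[set a : 'I_q | (row_of (IJ.2 (widen_ord (leqnSn q) a)) < vs)%N]| *:
      \prod_(a < q.+1) Sebar (IJ.1 a) (IJ.2 a).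

Definition d_elt (i : 'I_2) (r : nat) : Ug :=
  if r == 0%N then 1 else t_elt i i i r.
Definition e_elt (r : nat) : Ug := t_elt top_row bot_row 1 r.
Definition f_elt (r : nat) : Ug := t_elt bot_row top_row 1 r.

(* The same elements, seen in [Walg]; meaningful once they are known to lie in
   the subalgebra, see [drinfeld_presentation]. *)
Definition d_gen (i : 'I_2) (r : nat) : Walg := insubd 0 (d_elt i r).
Definition e_gen (r : nat) : Walg := insubd 0 (e_elt r).
Definition f_gen (r : nat) : Walg := insubd 0 (f_elt r).

Variable sigma : 'M[nat]_2.

Local Notation k := (pyr_k pi).
Local Notation l := (pyr_l pi).
Local Notation s12 := (sigma top_row bot_row).
Local Notation s21 := (sigma bot_row top_row).

(* The [d_i^{(r)}] are even, [e^{(r)}] and [f^{(r)}] are odd; the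
   supercommutators are written out accordingly. *)
Definition drinfeld_relations (B : algType K) (d : 'I_2 -> nat -> B)
    (e f : nat -> B) : Prop :=
  (forall i, d i 0%N = 1) /\
  (forall r, (k < r)%N -> d top_row r = 0) /\
  (forall i j r s, (0 < r)%N -> (0 < s)%N ->
     d i r * d j s - d j s * d i r = 0) /\
  (forall r s, (s12 < r)%N -> (s12 < s)%N -> e r * e s + e s * e r = 0) /\
  (forall r s, (s21 < r)%N -> (s21 < s)%N -> f r * f s + f s * f r = 0) /\
  (exists dt : nat -> B,
     (forall r, \sum_(a < r.+1) dt a * d top_row (r - a)%N = (r == 0%N)%:R) /\
     (forall r s, (s12 < r)%N -> (s21 < s)%N ->
        e r * f s + f s * e r =
        (-1) ^+ p top_row *: \sum_(a < r + s) dt a * d bot_row (r + s - 1 - a)%N)) /\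
  (forall i r s, (0 < r)%N -> (s12 < s)%N ->
     d i r * e s - e s * d i r =
     (-1) ^+ p top_row *: \sum_(a < r) d i a * e (r + s - 1 - a)%N) /\
  (forall i r s, (0 < r)%N -> (s21 < s)%N ->
     d i r * f s - f s * d i r =
     - ((-1) ^+ p top_row *: \sum_(a < r) f (r + s - 1 - a)%N * d i a)).

Inductive drinfeld_generator : Walg -> Prop :=
  | dg_d i r : (0 < r)%N -> drinfeld_generator (d_gen i r)
  | dg_e r : (s12 < r)%N -> drinfeld_generator (e_gen r)
  | dg_f r : (s21 < r)%N -> drinfeld_generator (f_gen r).

(* The presentation theorem for principal W-algebras as a proposition: the
   Drinfeld generators lie in W, generate it, satisfy the relations, and W is
   universal with this property ("subject only to"). *)
Definition drinfeld_presentation : Prop :=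
  (forall i r, (0 < r)%N -> in_W (d_elt i r)) /\
  (forall r, (s12 < r)%N -> in_W (e_elt r)) /\
  (forall r, (s21 < r)%N -> in_W (f_elt r)) /\
  (forall x : Walg, gen_subalg drinfeld_generator x) /\
  drinfeld_relations d_gen e_gen f_gen /\
  (forall (B : algType K) (d : 'I_2 -> nat -> B) (e f : nat -> B),
     drinfeld_relations d e f ->
     exists phi : {lrmorphism Walg -> B},
       (forall i r, (0 < r)%N -> phi (d_gen i r) = d i r) /\
       (forall r, (s12 < r)%N -> phi (e_gen r) = e r) /\
       (forall r, (s21 < r)%N -> phi (f_gen r) = f r)).

Inductive W0_gen : Walg -> Prop :=
  | W0_d1 r : (0 < r <= k)%N -> W0_gen (d_gen top_row r)
  | W0_d2 r : (0 < r <= l)%N -> W0_gen (d_gen bot_row r).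

Definition in_W0 : Walg -> Prop := gen_subalg W0_gen.

Definition in_Wsharp : Walg -> Prop :=
  gen_subalg (fun x => in_W0 x \/
    exists2 r, (s12 < r <= s12 + k)%N & x = e_gen r).

Definition Wsharp_proj_spec (f : Walg -> Walg) : Prop :=
  alg_hom_on in_Wsharp f /\
  (forall x, in_Wsharp x -> in_W0 (f x)) /\
  (forall x, in_W0 x -> f x = x) /\
  (forall r, (s12 < r)%N -> f (e_gen r) = 0).

(* The surjection from W^sharp to W^0 (existence and uniqueness on W^sharp are
   known facts). *)
Definition Wsharp_proj : Walg -> Walg :=
  xget (id : Walg -> Walg) [set f | Wsharp_proj_spec f].

Definition tableau : Type := (k.-tuple K * l.-tuple K)%type.

Definition row_equiv (A B : tableau) : Prop :=
  perm_eq A.1 B.1 /\ perm_eq A.2 B.2.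

Definition elem_sym (n : nat) (a : n.-tuple K) (r : nat) : K :=
  \sum_(S : {set 'I_n} | #|S| == r) \prod_(i in S) tnth a i.

Definition W0_char_spec (A : tableau) (c : Walg -> K^o) : Prop :=
  alg_hom_on in_W0 c /\
  (forall r, (0 < r <= k)%N -> c (d_gen top_row r) = elem_sym A.1 r) /\
  (forall r, (0 < r <= l)%N -> c (d_gen bot_row r) = elem_sym A.2 r).

(* The one-dimensional module C_A: [x] in W^0 acts on [1_A] as
   [W0_char A x]. It exists and is unique since W^0 is polynomial on its
   generators. *)
Definition W0_char (A : tableau) : Walg -> K^o :=
  xget (fun _ : Walg => 0 : K^o) [set c | W0_char_spec A c].

Definition Wsharp_char (A : tableau) (x : Walg) : K :=
  W0_char A (Wsharp_proj x).

(* W (x)_{W^sharp} C_A: as C_A is spanned by [1_A], W (x)_C C_A is the regular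
   module W^o, and the tensor product over W^sharp is its quotient by the
   elements wx (x) 1_A - w (x) x 1_A. *)
Definition verma_rel (A : tableau) : submodule (Walg^o : lmodType Walg) :=
  submod_span (fun v : Walg^o => exists w x : Walg,
    in_Wsharp x /\ v = w * x - Wsharp_char A x *: w).

Definition verma (A : tableau) : lmodType Walg := quot_mod (verma_rel A).

Definition full_submod (V : lmodType Walg) : submodule V :=
  submod_span (fun _ : V => True).

(* The kernel of the irreducible quotient of the Verma module (which exists and
   is unique). *)
Definition verma_rad (A : tableau) : submodule (verma A) :=
  xget (full_submod (verma A)) [set N | irreducible_mod (quot_mod N)].

Definition Lbar (A : tableau) : lmodType Walg := quot_mod (verma_rad A).

Definition row_representatives (T : tableau -> Prop) : Prop :=
  (forall A, exists2 B, T B & row_equiv A B) /\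
  (forall A B, T A -> T B -> row_equiv A B -> A = B).

End PrincipalW.

(* Main.v *)
Require Import Defs.
Set Warnings "-notation-overridden,-ambiguous-paths".
From HB Require Import structures.
From mathcomp Require Import all_boot all_order all_algebra.
From mathcomp Require Import boolp classical_sets functions cardinality.
From mathcomp Require Import reals complex ereal measure lebesgue_measure.
From mathcomp Require Import zify.
From mathcomp Require finmap.

Set Implicit Arguments.
Unset Strict Implicit.
Unset Printing Implicit Defensive.

Import GRing.Theory.

Local Open Scope ring_scope.

(** The presentation makes every module question one about a few
    supercommutation relations.  After a change of signs and a shift of indices
    (normal_relations) the generators are commuting D's, anticommuting E's and
    anticommuting F's; every anticommutator of an E with an F lies in the algebra
    of the D's, and commuting a D past an E or an F only changes indices.

    Let V be an irreducible module and call a vector singular when all E's kill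
    it.  As d_1^(r) = 0 for r > k, the E's with index below k generate the others;
    they anticommute and square to zero, so nonzero singular vectors exist
    (singular_exists).  For the same reason the sum of the subspaces F s V is not
    V (Fimage_proper).  If u is singular, V is spanned by monomials in the F's
    applied to the D-module generated by u, so two singular vectors differ from
    one another by an element of that D-module plus a singular vector in the sum
    of the F s V; the latter would generate a proper submodule, hence vanishes.
    So the singular vectors form a simple module over the commutative algebra of
    the D's (singular_Dspan).  V has countable dimension while the complex field
    is uncountable, and Amitsur's argument (amitsur_eigenvector) turns simplicity
    into scalars: each D acts on the singular vectors by a number (D_scalar).
    Monomials in the F's with index below k, applied to a singular vector, then
    span V, which is finite dimensional.  The scalars are elementary symmetric
    functions of the entries of a tableau because the field is algebraically
    closed, and d_2^(r) kills singular vectors for r > l (D_bot_large).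
    Conversely a weight determines the module: the submodule of V x V' generated
    by a pair of singular vectors of equal weight is the graph of an isomorphism
    (weight_iso), and the weight determines the tableau up to row equivalence
    (row_equiv_weight).

    What remains is existence: the one-dimensional modules of W^0, the projection
    from W^sharp onto W^0 and an irreducible quotient of each Verma module.  All
    come from explicit modules (fock_representation).  Over a coefficient algebra
    C with commuting elements al_r, be_s, take the exterior algebra of the module
    C[x] / (sum of al_a x^(k-a)), with E's acting as contractions and F's as
    creation operators; the D's are forced by their commutation relations.  It
    contains vacuum vectors on which d_1^(r) and d_2^(r) act as al_r and be_r.
    With C = W and al_r, be_r the generators of W^0, the action on the vacuum is
    the projection W^sharp -> W^0; with C the complex field and elementary
    symmetric functions of a tableau, it gives the character of W^0 and a module
    in which every nonzero vector can be carried to the vacuum, so that the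
    annihilator of the vacuum cuts out an irreducible quotient of the Verma
    module. *)

(** * Double sums and convolution of sequences *)

Lemma sum_triangle (V : zmodType) (r : nat) (H : nat -> nat -> V) :
  \sum_(a < r) \sum_(b < a) H a b = \sum_(b < r) \sum_(b.+1 <= a < r) H a b.
Proof.
transitivity (\sum_(a < r) \sum_(b < r | (b < a)%N) H a b).
  by apply: eq_bigr => a _; rewrite (big_ord_widen r (H a)) // ltnW.
rewrite (exchange_big_dep xpredT) //=; apply: eq_bigr => b _.
by rewrite big_geq_mkord.
Qed.

(** For fixed b, the reflection a -> r + b - a exchanges the gaps a - b.+1 and
    r - a.+1.  Double commutators produce such sums, and this symmetry is what
    cancels them. *)
Lemma sum_triangle_swap (V : zmodType) (r : nat) (G : nat -> nat -> nat -> V) :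
  \sum_(a < r) \sum_(b < a) G b (a - b.+1)%N (r - a.+1)%N =
  \sum_(a < r) \sum_(b < a) G b (r - a.+1)%N (a - b.+1)%N.
Proof.
rewrite (sum_triangle r (fun a b => G b (a - b.+1)%N (r - a.+1)%N)).
rewrite (sum_triangle r (fun a b => G b (r - a.+1)%N (a - b.+1)%N)).
apply: eq_bigr => b _; rewrite big_nat_rev /= [LHS]big_nat [RHS]big_nat.
by apply: eq_bigr => a /andP[ba ar]; congr (G b _ _); lia.
Qed.

Section Convolution.
Variable B : nzRingType.
Implicit Types x y z : nat -> B.

(** A sequence x stands for the series with coefficients x n in a formal variable,
    and conv for the product of series. *)
Definition conv x y n := \sum_(a < n.+1) x a * y (n - a)%N.

Let P n x : {poly B} := \poly_(i < n.+1) x i.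

Lemma coef_conv x y n j : (j <= n)%N -> (P n x * P n y)`_j = conv x y j.
Proof.
move=> jn; rewrite coefM; apply: eq_bigr => a _.
have aj : (a <= j)%N by rewrite -ltnS.
by rewrite !coef_poly !ltnS (leq_trans aj jn) (leq_trans (leq_subr _ _) jn).
Qed.

Lemma convA x y z n : conv x (conv y z) n = conv (conv x y) z n.
Proof.
transitivity ((P n x * P n y * P n z)`_n).
  rewrite -mulrA coefM; apply: eq_bigr => a _.
  by rewrite coef_conv ?leq_subr // coef_poly ltn_ord.
rewrite coefM; apply: eq_bigr => a _; have an : (a <= n)%N by rewrite -ltnS.
by rewrite coef_conv // coef_poly ltnS leq_subr.
Qed.

Lemma conv1 y n : conv (fun r => (r == 0%N)%:R) y n = y n.
Proof.
by rewrite /conv big_ord_recl mul1r subn0 big1 ?addr0 // => a _; rewrite mul0r.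
Qed.

Lemma convC x y n : (forall i j, x i * y j = y j * x i) -> conv x y n = conv y x n.
Proof.
move=> xy; rewrite /conv (reindex_inj rev_ord_inj) /=; apply: eq_bigr => a _.
by rewrite xy subSS; congr (y _ * x _); have := ltn_ord a; lia.
Qed.

(** Each coefficient of the inverse series depends on all the previous ones, so
    that the recursion builds the list of the first n coefficients. *)
Fixpoint inverse_seq x n : seq B :=
  if n is n'.+1 then
    let s := inverse_seq x n' in
    rcons s ((n' == 0%N)%:R - \sum_(a < n') s`_a * x (n' - a)%N)
  else [::].
Definition conv_inverse x n := (inverse_seq x n.+1)`_n.

Lemma size_inverse_seq x n : size (inverse_seq x n) = n.
Proof. by elim: n => //= n IH; rewrite size_rcons IH. Qed.

Lemma nth_inverse_seq x n i : (i < n)%N -> (inverse_seq x n)`_i = conv_inverse x i.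
Proof.
elim: n => // n IH; rewrite ltnS leq_eqVlt => /predU1P[->//|iN].
by rewrite /= nth_rcons size_inverse_seq iN IH.
Qed.

Lemma conv_inverseE x n : conv_inverse x n =
  (n == 0%N)%:R - \sum_(a < n) conv_inverse x a * x (n - a)%N.
Proof.
rewrite {1}/conv_inverse /= nth_rcons size_inverse_seq ltnn eqxx.
by congr (_ - _); apply: eq_bigr => a _; rewrite nth_inverse_seq.
Qed.

Lemma conv_inverseP x n : x 0%N = 1 -> conv (conv_inverse x) x n = (n == 0%N)%:R.
Proof. by move=> x0; rewrite /conv big_ord_recr /= subnn x0 mulr1 conv_inverseE subrKC. Qed.

Lemma conv_inverse_comm x c : (forall n, c * x n = x n * c) ->
  forall n, c * conv_inverse x n = conv_inverse x n * c.
Proof.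
move=> cx; elim/ltn_ind => n IH; rewrite conv_inverseE mulrBr mulrBl.
rewrite mulr_sumr mulr_suml commr_nat; congr (_ - _); apply: eq_bigr => a _.
by rewrite mulrA IH // -!mulrA cx.
Qed.

End Convolution.

(** * The relations without signs and shifts *)

(** Up to a power of (-1)^|1|, E t and F s stand for e^(s12 + 1 + t) and
    f^(s21 + 1 + s), with m = s12 + s21 + 1; h is the series d_1^-1 d_2, which turns
    the convolution in the bracket of e and f into a single coefficient. *)
Definition normal_relations (K : fieldType) (B : algType K) (k m : nat)
    (d : 'I_2 -> nat -> B) (E F h : nat -> B) : Prop :=
  [/\ (forall i, d i 0%N = 1) /\ (forall r, (k < r)%N -> d top_row r = 0),
      forall i j r s, d i r * d j s = d j s * d i r,
      (forall s t, E s * E t = - (E t * E s)) /\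
      (forall s t, F s * F t = - (F t * F s)),
      (forall t s, E t * F s + F s * E t = h (s + t + m)%N) /\
      (forall n, conv (d top_row) h n = d bot_row n)
    & (forall i r t, d i r * E t =
         E t * d i r + \sum_(a < r) d i a * E (r - a.+1 + t)%N) /\
      (forall i r s, d i r * F s =
         F s * d i r - \sum_(a < r) F (r - a.+1 + s)%N * d i a)].

(** * The algebra of endomorphisms of a vector space *)
Section LinearEndomorphisms.
Variables (K : fieldType) (U : lmodType K) (nonzero : exists u : U, u != 0).

Record endo := Endo { endo_val : U -> U; endo_linear : linear endo_val }.

(** The type records a proof that U is nonzero, since 1 must differ from 0 in an
    algebra. *)
Definition endo_space & (exists u : U, u != 0) := endo.
Local Notation End := (endo_space nonzero).
Definition endo_app (x : End) : U -> U := endo_val x.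

Lemma endo_eq (x y : End) : endo_app x =1 endo_app y -> x = y.
Proof.
case: x y => [f fl] [g gl] /= /funext /= fg; rewrite /endo_app /= in fg.
by case: _ / fg in gl *; rewrite (Prop_irrelevance fl gl).
Qed.

HB.instance Definition _ := gen_eqMixin End.
HB.instance Definition _ := gen_choiceMixin End.
HB.instance Definition _ (x : End) :=
  GRing.isLinear.Build K U U _ (endo_app x) (@endo_linear x).

Definition mk_endo (f : {linear U -> U}) : End := @Endo f (linearP f).

Let zeroL : linear (fun _ : U => 0 : U).
Proof. by move=> c u v; rewrite scaler0 add0r. Qed.
Let addL (x y : End) : linear (fun u => endo_app x u + endo_app y u).
Proof. by move=> c u v; rewrite !linearP scalerDr addrACA. Qed.
Let oppL (x : End) : linear (fun u => - endo_app x u).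
Proof. by move=> c u v; rewrite linearP opprD scalerN. Qed.
Let mulL (x y : End) : linear (fun u => endo_app x (endo_app y u)).
Proof. by move=> c u v; rewrite !linearP. Qed.
Let oneL : linear (fun u : U => u). Proof. by []. Qed.
Let scaleL a (x : End) : linear (fun u => a *: endo_app x u).
Proof. by move=> c u v; rewrite linearP scalerDr !scalerA mulrC. Qed.

Let zero : End := Endo zeroL.
Let add (x y : End) : End := Endo (addL x y).
Let opp (x : End) : End := Endo (oppL x).
Let mul (x y : End) : End := Endo (mulL x y).
Let one : End := Endo oneL.
Let scale a (x : End) : End := Endo (scaleL a x).

Let addA : associative add.
Proof. by move=> x y z; apply: endo_eq => u; apply: addrA. Qed.
Let addC : commutative add.
Proof. by move=> x y; apply: endo_eq => u; apply: addrC. Qed.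
Let add0 : left_id zero add.
Proof. by move=> x; apply: endo_eq => u; apply: add0r. Qed.
Let addN : left_inverse zero opp add.
Proof. by move=> x; apply: endo_eq => u; apply: addNr. Qed.
HB.instance Definition _ := GRing.isZmodule.Build End addA addC add0 addN.

Let mulA : associative mul.
Proof. by move=> x y z; apply: endo_eq. Qed.
Let mul1 : left_id one mul. Proof. by move=> x; apply: endo_eq. Qed.
Let mulr1 : right_id one mul. Proof. by move=> x; apply: endo_eq. Qed.
Let mulDl : left_distributive mul +%R.
Proof. by move=> x y z; apply: endo_eq. Qed.
Let mulDr : right_distributive mul +%R.
Proof. by move=> x y z; apply: endo_eq => u; apply: linearD. Qed.
Let one_neq0 : one != 0.
Proof.
case: nonzero => u /eqP u0; apply/eqP => /(congr1 (fun x => endo_app x u)).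
exact: u0.
Qed.
HB.instance Definition _ := GRing.Zmodule_isNzRing.Build End
  mulA mul1 mulr1 mulDl mulDr one_neq0.

Let scaleA a b x : scale a (scale b x) = scale (a * b) x.
Proof. by apply: endo_eq => u; apply: scalerA. Qed.
Let scale1 : left_id 1 scale.
Proof. by move=> x; apply: endo_eq => u; apply: scale1r. Qed.
Let scaleDr : right_distributive scale +%R.
Proof. by move=> a x y; apply: endo_eq => u; apply: scalerDr. Qed.
Let scaleDl x : {morph scale^~ x : a b / a + b}.
Proof. by move=> a b; apply: endo_eq => u; apply: scalerDl. Qed.
HB.instance Definition _ := GRing.Zmodule_isLmodule.Build K End
  scaleA scale1 scaleDr scaleDl.
Let scaleAl (a : K) (x y : End) : a *: (x * y) = a *: x * y.
Proof. exact: endo_eq. Qed.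
HB.instance Definition _ := GRing.Lmodule_isLalgebra.Build K End scaleAl.
Let scaleAr (a : K) (x y : End) : a *: (x * y) = x * (a *: y).
Proof. by apply: endo_eq => u; rewrite [RHS]linearZ. Qed.
HB.instance Definition _ := GRing.Lalgebra_isAlgebra.Build K End scaleAr.

Lemma endo_appM (x y : End) u : endo_app (x * y) u = endo_app x (endo_app y u).
Proof. by []. Qed.
Lemma endo_appD (x y : End) u : endo_app (x + y) u = endo_app x u + endo_app y u.
Proof. by []. Qed.
Lemma endo_appN (x : End) u : endo_app (- x) u = - endo_app x u.
Proof. by []. Qed.
Lemma endo_app0 u : endo_app (0 : End) u = 0.
Proof. by []. Qed.
Lemma endo_app1 u : endo_app (1 : End) u = u.
Proof. by []. Qed.
Lemma endo_appZ a (x : End) u : endo_app (a *: x) u = a *: endo_app x u.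
Proof. by []. Qed.
Lemma endo_app_sum (I : Type) (s : seq I) (P : pred I) (F : I -> End) u :
  endo_app (\sum_(i <- s | P i) F i) u = \sum_(i <- s | P i) endo_app (F i) u.
Proof. by elim/big_rec2: _ => // i y x _ <-. Qed.
Definition endo_appE :=
  (endo_appM, endo_appD, endo_appN, endo_app0, endo_app1, endo_appZ, endo_app_sum).

End LinearEndomorphisms.

(** * The Fock module *)
Lemma subrACA (V : zmodType) (a b c d : V) : (a - b) - (c - d) = (a - c) - (b - d).
Proof. by rewrite !opprB addrACA [RHS]addrACA (addrC (- b)). Qed.

Section Fock.
Variables (K : fieldType) (C : algType K) (k m : nat).
Variables (al h : nat -> C).
Hypothesis al_comm : forall r s, al r * al s = al s * al r.
Hypothesis al_h_comm : forall r s, al r * h s = h s * al r.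
Hypothesis h_comm : forall r s, h r * h s = h s * h r.
Hypothesis al_h : forall n, (k + m <= n)%N ->
  \sum_(a < k.+1) al a * h (n - a)%N = 0.

Hypothesis char2 : (2%:R : K) <> 0.

Notation Psi := (seq nat -> C).
Implicit Types (w u : seq nat).

Definition contract (t : nat) (phi : Psi) : Psi := fun w => phi (t :: w).
Definition lscale (x : C) (phi : Psi) : Psi := fun w => x * phi w.

(** A vector of the module is recorded by the vacuum components of its images
    under words in the E's: phi [:: t1; ..; tj] is that of E tj .. E t1 phi.  Thus
    E t is contract t, and the values of D r phi and F s phi at t :: w are forced by
    the relations that move E t to the right of D r or F s. *)
Fixpoint D_at (w : seq nat) (r : nat) (phi : Psi) : C :=
  if w is t :: w' then
    D_at w' r (contract t phi) - \sum_(a < r) D_at w' a (contract (r - a.+1 + t) phi)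
  else al r * phi [::].

Fixpoint F_at (w : seq nat) (s : nat) (phi : Psi) : C :=
  if w is t :: w' then h (s + t + m) * phi w' - F_at w' s (contract t phi) else 0.

Lemma lin_at c (phi psi : Psi) w : (c *: phi + psi) w = c *: phi w + psi w.
Proof. by []. Qed.

Lemma contract_linear t : linear (contract t). Proof. by []. Qed.
HB.instance Definition _ t := GRing.isLinear.Build K Psi Psi _ _ (contract_linear t).

Lemma lscale_linear x : linear (lscale x).
Proof.
by move=> c phi psi; apply/funext => w; rewrite lin_at /lscale lin_at mulrDr -scalerAr.
Qed.
HB.instance Definition _ x := GRing.isLinear.Build K Psi Psi _ _ (lscale_linear x).

Lemma D_at_linear w r : linear (D_at w r : Psi -> C).
Proof.
elim: w r => [|t w IH] r c phi psi /=; first by rewrite lin_at mulrDr -scalerAr.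
rewrite linearP IH; under eq_bigr => a _ do rewrite linearP IH.
by rewrite big_split /= -scaler_sumr scalerBr opprD addrACA.
Qed.
HB.instance Definition _ w r := GRing.isLinear.Build K Psi C _ _ (D_at_linear w r).

Lemma F_at_linear w s : linear (F_at w s : Psi -> C).
Proof.
elim: w s => [|t w IH] s c phi psi /=; first by rewrite scaler0 addr0.
by rewrite linearP IH lin_at mulrDr opprD addrACA scalerBr -scalerAr.
Qed.
HB.instance Definition _ w s := GRing.isLinear.Build K Psi C _ _ (F_at_linear w s).

Lemma D_at_lscale w r x phi : (forall r, x * al r = al r * x) ->
  D_at w r (lscale x phi) = x * D_at w r phi.
Proof.
move=> xal; elim: w r phi => [|t w IH] r phi /=; first by rewrite /lscale !mulrA xal.
rewrite mulrBr mulr_sumr -(IH r); congr (_ - _).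
by apply: eq_bigr => a _; rewrite -IH.
Qed.

Lemma F_at_lscale w s x phi : (forall r, x * h r = h r * x) ->
  F_at w s (lscale x phi) = x * F_at w s phi.
Proof.
move=> xh; elim: w phi => [|t w IH] phi /=; first by rewrite mulr0.
by rewrite mulrBr /lscale !mulrA xh -IH.
Qed.

(** The first condition says that the E's anticommute; the second one, that E t
    depends only on the class of x^t modulo the polynomial sum of al a x^(k - a).
    So for commutative C the module is the exterior algebra of the dual of
    C[x] / (sum of al a x^(k - a)), all of whose elements are bounded. *)
Definition alternating (phi : Psi) :=
  forall u s t w, phi (u ++ s :: t :: w) = - phi (u ++ t :: s :: w).
Definition root_condition (phi : Psi) :=
  forall u s w, \sum_(a < k.+1) al a * phi (u ++ (k - a + s)%N :: w) = 0.
Definition bounded (phi : Psi) := exists n, forall w, (n <= size w)%N -> phi w = 0.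

Definition fock_pred (phi : Psi) : bool :=
  `[< [/\ alternating phi, root_condition phi & bounded phi] >].

Lemma fock_closed : submod_closed (fock_pred : {pred Psi}).
Proof.
split=> [|c phi psi].
  apply/asboolP; split=> [u s t w|u s w|].
  - by rewrite oppr0.
  - by rewrite big1 // => a _; rewrite mulr0.
  - by exists 0%N.
move=> /asboolP[Ap Rp [n np]] /asboolP[As Rs [n' ns]]; apply/asboolP.
split=> [u s t w|u s w|].
- by rewrite !lin_at Ap As scalerN opprD.
- under eq_bigr => a _ do rewrite lin_at mulrDr -scalerAr.
  by rewrite big_split /= -scaler_sumr Rp Rs scaler0 addr0.
- exists (maxn n n') => w; rewrite geq_max => /andP[nw n'w].
  by rewrite lin_at np // ns // scaler0 addr0.
Qed.
HB.instance Definition _ := GRing.isSubmodClosed.Build K Psi fock_pred fock_closed.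

Record fock := Fock { fock_val : Psi; fock_valP : fock_pred fock_val }.
HB.instance Definition _ := [isSub for fock_val].
HB.instance Definition _ := [Choice of fock by <:].
HB.instance Definition _ := [SubChoice_isSubLmodule of fock by <:].

Lemma fock_contract t (phi : Psi) : fock_pred phi -> fock_pred (contract t phi).
Proof.
move=> /asboolP[A R [n b]]; apply/asboolP; split=> [u s t' w|u s w|].
- exact: (A (t :: u)).
- exact: (R (t :: u)).
- by exists n => w nw; apply: b; apply: leqW.
Qed.

Lemma fock_lscale x (phi : Psi) : (forall r, x * al r = al r * x) ->
  fock_pred phi -> fock_pred (lscale x phi).
Proof.
move=> xal /asboolP[A R [n b]]; apply/asboolP; split=> [u s t w|u s w|].
- by rewrite /lscale A mulrN.
- under eq_bigr => a _ do rewrite /lscale mulrA -xal -mulrA.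
  by rewrite -mulr_sumr R mulr0.
- by exists n => w nw; rewrite /lscale b ?mulr0.
Qed.

Lemma contract_alternating phi s t : fock_pred phi ->
  contract s (contract t phi) = - contract t (contract s phi).
Proof. by move=> /asboolP[A _ _]; apply/funext => w; apply: (A [::]). Qed.

Lemma contract_root phi s : fock_pred phi ->
  \sum_(a < k.+1) lscale (al a) (contract (k - a + s)%N phi) = 0.
Proof.
move=> /asboolP[_ R _]; rewrite fct_sumE; apply/funext => u.
exact: (R [::]).
Qed.

Lemma D_at2E w s t r phi : D_at (s :: t :: w) r phi =
  D_at w r (contract t (contract s phi))
  - \sum_(b < r) D_at w b (contract (r - b.+1 + t) (contract s phi))
  - \sum_(a < r) D_at w a (contract t (contract (r - a.+1 + s) phi))
  + \sum_(a < r) \sum_(b < a) D_at w b (contract (a - b.+1 + t) (contract (r - a.+1 + s) phi)).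
Proof.
by rewrite /= -!addrA; do 2!congr (_ + _); rewrite sumrB opprB addrC.
Qed.

(** Moving D r to the left of two contractions gives the four terms of D_at2E:
    exchanging s and t negates the first, exchanges the two middle ones up to
    sign, and negates the double sum by the reflection of its indices. *)
Lemma D_at_alternating r phi : fock_pred phi ->
  alternating (fun w => D_at w r phi).
Proof.
move=> phiU u; elim: u r phi phiU => [|t' u IH] r phi phiU s t w; last first.
  rewrite /= IH ?fock_contract // opprD; congr (_ + _); congr (- _); rewrite -sumrN.
  by apply: eq_bigr => a _; rewrite IH ?fock_contract.
have swap b i j : D_at w b (contract i (contract j phi)) = - D_at w b (contract j (contract i phi)).
  by rewrite contract_alternating // linearN.
pose A s t := \sum_(b < r) D_at w b (contract (r - b.+1 + t) (contract s phi)).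
pose B s t := \sum_(a < r) D_at w a (contract t (contract (r - a.+1 + s) phi)).
pose S s t := \sum_(a < r) \sum_(b < a)
  D_at w b (contract (a - b.+1 + t) (contract (r - a.+1 + s) phi)).
have AB s' t' : A s' t' = - B t' s'.
  by rewrite /A /B -sumrN; apply: eq_bigr => a _; rewrite swap.
have BA s' t' : B s' t' = - A t' s' by rewrite AB opprK.
have SS : S s t = - S t s.
  rewrite /S (sum_triangle_swap r
    (fun b i j => D_at w b (contract (i + t)%N (contract (j + s)%N phi)))).
  rewrite -sumrN; apply: eq_bigr => a _; rewrite -sumrN.
  by apply: eq_bigr => b _; rewrite swap.
rewrite !D_at2E swap -/(A s t) -/(B s t) -/(S s t) -/(A t s) -/(B t s) -/(S t s).
rewrite (AB s t) (BA s t) SS !opprD !opprK; congr (_ + _).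
by rewrite addrAC.
Qed.

Lemma fock_D_at r phi : fock_pred phi -> fock_pred (fun w => D_at w r phi).
Proof.
move=> phiU; apply/asboolP; split; first exact: D_at_alternating.
- move=> u; elim: u r phi phiU => [|t u IH] r phi phiU s w /=;
    under eq_bigr => a _ do rewrite mulrBr mulr_sumr;
    rewrite sumrB exchange_big /=; last first.
    by rewrite IH ?fock_contract // big1 ?subr0 // => b _; rewrite IH ?fock_contract.
  have R0 r' s' : \sum_(a < k.+1) al a * D_at w r' (contract (k - a + s')%N phi) = 0.
    under eq_bigr => a _ do rewrite -D_at_lscale //.
    by rewrite -linear_sum /= contract_root ?linear0.
  rewrite R0 big1 ?subr0 // => b _.
  by under eq_bigr => a _ do rewrite addnCA.
- case/asboolP: phiU => _ _ [n b]; exists n => w.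
  elim: w n r phi b => [|t w IH] n r phi b nw /=; first by rewrite b ?mulr0.
  have IHt a t' : D_at w a (contract t' phi) = 0.
    by apply: (IH n.-1) => [w' nw'|]; [apply: b|move: nw] => /=; lia.
  by rewrite IHt big1 ?subr0.
Qed.

(** For the second condition, the term of F with h contributes a coefficient of
    the product al * h of index at least k + m, which al_h makes zero. *)
Lemma fock_F_at s phi : fock_pred phi -> fock_pred (fun w => F_at w s phi).
Proof.
move=> phiU; apply/asboolP; split.
- move=> u; elim: u phi phiU => [|t' u IH] phi phiU i j w /=.
    rewrite contract_alternating // linearN.
    by rewrite opprK opprB opprD addrA addrAC.
  rewrite opprB IH ?fock_contract // addrC opprK; congr (_ + _).
  by case/asboolP: phiU => A _ _; rewrite A mulrN.
- move=> u; elim: u phi phiU => [|t u IH] phi phiU i w /=.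
    under eq_bigr => a _ do rewrite mulrBr mulrA -F_at_lscale //.
    rewrite sumrB -mulr_suml -linear_sum /= contract_root // linear0 subr0.
    rewrite (eq_bigr (fun a : 'I_k.+1 => al a * h (s + i + (k + m) - a)%N)).
      by rewrite al_h ?leq_addl // mul0r.
    by move=> a _; congr (_ * h _); have := ltn_ord a; lia.
  under eq_bigr => a _ do rewrite mulrBr mulrA al_h_comm -mulrA.
  rewrite sumrB IH ?fock_contract // subr0 -mulr_sumr.
  by case/asboolP: phiU => _ R _; rewrite R mulr0.
- case/asboolP: phiU => _ _ [n b]; exists n.+1 => w.
  elim: w n phi b => [|t w IH] n phi b nw //=.
  rewrite b ?mulr0 ?sub0r; last by move: nw => /=; lia.
  case: n b nw => [|n] b nw; last by rewrite (IH n) ?oppr0 // => w' nw'; apply: b => /=; lia.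
  rewrite (_ : contract t phi = 0) ?linear0 ?oppr0 //.
  by apply/funext => w'; apply: b.
Qed.

Definition vac_fun (c : C) : Psi := fun w => if w is [::] then c else 0.
Lemma fock_vac c : fock_pred (vac_fun c).
Proof.
apply/asboolP; split=> [u s t w|u s w|].
- by case: u => [|? ?]; rewrite oppr0.
- by rewrite big1 // => a _; case: u => [|? ?]; rewrite mulr0.
- by exists 1%N; case.
Qed.
Definition vac (c : C) : fock := Fock (fock_vac c).

Definition ev (w : seq nat) (phi : fock) : C := fock_val phi w.
Arguments ev : simpl never.
Lemma ev_linear w : linear (ev w). Proof. by []. Qed.
HB.instance Definition _ w := GRing.isLinear.Build K fock C _ _ (ev_linear w).

Lemma evD w (phi psi : fock) : ev w (phi + psi) = ev w phi + ev w psi.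
Proof. exact: linearD. Qed.
Lemma evN w (phi : fock) : ev w (- phi) = - ev w phi.
Proof. exact: linearN. Qed.
Lemma ev_sum w n (phi : 'I_n -> fock) :
  ev w (\sum_(a < n) phi a) = \sum_(a < n) ev w (phi a).
Proof. exact: linear_sum. Qed.

Lemma fock_eq (phi psi : fock) : (forall w, ev w phi = ev w psi) -> phi = psi.
Proof. by move=> e; apply: val_inj; apply/funext. Qed.

Lemma fock_nonzero : exists u : fock, u != 0.
Proof.
exists (vac 1); apply/eqP => /(congr1 (ev [::])); rewrite linear0.
by move/eqP; rewrite oner_eq0.
Qed.
Notation End := (endo_space fock_nonzero).

Section Lift.
Variables (g : Psi -> Psi) (gL : linear g).
Hypothesis gU : forall phi, fock_pred phi -> fock_pred (g phi).
Definition lift_fun (phi : fock) : fock := Fock (gU (fock_valP phi)).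
Lemma lift_linear : linear lift_fun.
Proof. by move=> c phi psi; apply: val_inj; apply: gL. Qed.
Definition lift_op : End := Endo lift_linear.
End Lift.

Lemma Dop_linear r : linear (fun phi w => D_at w r phi).
Proof. by move=> c phi psi; apply/funext => w; apply: D_at_linear. Qed.
Lemma Fop_linear s : linear (fun phi w => F_at w s phi).
Proof. by move=> c phi psi; apply/funext => w; apply: F_at_linear. Qed.

Definition Eop t : End := lift_op (contract_linear t) (@fock_contract t).
Definition Dop r : End := lift_op (Dop_linear r) (@fock_D_at r).
Definition Fop s : End := lift_op (Fop_linear s) (@fock_F_at s).
Lemma h_al_comm n r : h n * al r = al r * h n. Proof. by rewrite al_h_comm. Qed.
Definition Hop n : End :=
  lift_op (lscale_linear (h n)) (fun phi => @fock_lscale (h n) phi (h_al_comm n)).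
Lemma op_eq (x y : End) :
  (forall (phi : fock) w, ev w (endo_app x phi) = ev w (endo_app y phi)) -> x = y.
Proof. by move=> e; apply: endo_eq => phi; apply: fock_eq => w; apply: e. Qed.

(** Operators agree at w when their values have the same component at w.  Since
    the component at t :: w is the component at w after E t, an identity between
    operators follows by induction on w from an expression of E t * x through
    right multiples of operators of the same family (op_ind): agreement at w is
    stable under right multiplication. *)
Definition agree (w : seq nat) (x y : End) :=
  forall phi : fock, ev w (endo_app x phi) = ev w (endo_app y phi).

Lemma agreeD w x x' y y' :
  agree w x x' -> agree w y y' -> agree w (x + y) (x' + y').
Proof. by move=> ex ey phi; rewrite !endo_appD !evD ex ey. Qed.
Lemma agreeN w x x' : agree w x x' -> agree w (- x) (- x').
Proof. by move=> ex phi; rewrite !endo_appN !evN ex. Qed.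
Lemma agreeM w x x' y : agree w x x' -> agree w (x * y) (x' * y).
Proof. by move=> ex phi; rewrite !endo_appM ex. Qed.
Lemma agree_sum w n (x y : 'I_n -> End) : (forall a, agree w (x a) (y a)) ->
  agree w (\sum_(a < n) x a) (\sum_(a < n) y a).
Proof.
by move=> exy phi; rewrite !endo_app_sum !ev_sum; apply: eq_bigr => a _; apply: exy.
Qed.

Lemma agree0D w x y : agree w x 0 -> agree w y 0 -> agree w (x + y) 0.
Proof. by rewrite -[in agree w (x + y) _](addr0 (0 : End)); apply: agreeD. Qed.
Lemma agree0N w x : agree w x 0 -> agree w (- x) 0.
Proof. by rewrite -[in agree w (- x) _](oppr0 End); apply: agreeN. Qed.
Lemma agree0M w x y : agree w x 0 -> agree w (x * y) 0.
Proof. by rewrite -[in agree w (x * y) _](mul0r y); apply: agreeM. Qed.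

Lemma agree0_sum w n (x : 'I_n -> End) : (forall a, agree w (x a) 0) ->
  agree w (\sum_(a < n) x a) 0.
Proof.
by move=> x0 phi; rewrite endo_app_sum ev_sum big1 // => a _; rewrite x0.
Qed.

Lemma op_ind (I : Type) (x y : I -> End) :
  (forall i, agree [::] (x i) (y i)) ->
  (forall i t w, (forall j, agree w (x j) (y j)) ->
    agree w (Eop t * x i) (Eop t * y i)) ->
  forall i, x i = y i.
Proof.
move=> base step i; apply: op_eq => phi w.
elim: w i phi => [|t w IH] i phi; first exact: base.
exact: (step i t w IH phi).
Qed.

Lemma op_ind2 (x y : nat -> nat -> End) :
  (forall r s, agree [::] (x r s) (y r s)) ->
  (forall r s t w, (forall i j, agree w (x i j) (y i j)) ->
    agree w (Eop t * x r s) (Eop t * y r s)) ->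
  forall r s, x r s = y r s.
Proof.
move=> base step r s.
apply: (op_ind (x := fun i => x i.1 i.2) (y := fun i => y i.1 i.2) _ _ (r, s)).
  by move=> i; apply: base.
by move=> i t w IH; apply: step => a b; apply: (IH (a, b)).
Qed.

Lemma ED t r : Eop t * Dop r =
  Dop r * Eop t - \sum_(a < r) Dop a * Eop (r - a.+1 + t).
Proof. by apply: op_eq => phi w; rewrite !endo_appE linearB linear_sum. Qed.

Lemma EF t s : Eop t * Fop s = Hop (s + t + m) - Fop s * Eop t.
Proof. by apply: op_eq => phi w; rewrite !endo_appE linearB. Qed.

Lemma EE s t : Eop s * Eop t = - (Eop t * Eop s).
Proof.
apply: op_eq => phi w; rewrite !endo_appE linearN.
by case/asboolP: (fock_valP phi) => A _ _; apply: (A [::]).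
Qed.

Lemma HE n t : Hop n * Eop t = Eop t * Hop n.
Proof. exact: op_eq. Qed.
Lemma HD n r : Hop n * Dop r = Dop r * Hop n.
Proof. by apply: op_eq => phi w; symmetry; apply: D_at_lscale. Qed.
Lemma HF n s : Hop n * Fop s = Fop s * Hop n.
Proof. by apply: op_eq => phi w; symmetry; apply: F_at_lscale. Qed.
Lemma HH n n' : Hop n * Hop n' = Hop n' * Hop n.
Proof. by apply: op_eq => phi w; rewrite /ev /= /lscale !mulrA h_comm. Qed.

Lemma EDD t r s : Eop t * (Dop r * Dop s) =
  Dop r * Dop s * Eop t
  - (\sum_(b < s) Dop r * Dop b * Eop (s - b.+1 + t)
     + \sum_(a < r) Dop a * Dop s * Eop (r - a.+1 + t))
  + \sum_(a < r) \sum_(b < s) Dop a * Dop b * Eop (s - b.+1 + (r - a.+1 + t)).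
Proof.
rewrite mulrA ED mulrBl -(mulrA _ (Eop t)) ED mulrBr mulrA mulr_sumr mulr_suml.
rewrite opprD addrA -[RHS]addrA; congr (_ - _ + _).
  by apply: eq_bigr => b _; rewrite mulrA.
rewrite addrC -sumrB -sumrN; apply: eq_bigr => a _.
rewrite -(mulrA _ (Eop _) (Dop s)) ED mulrBr !mulrA opprB; congr (_ - _).
by rewrite mulr_sumr; apply: eq_bigr => b _; rewrite mulrA.
Qed.

(** EDD is symmetric in r and s apart from the order of the products of two D's. *)
Lemma DD : forall r s, Dop r * Dop s = Dop s * Dop r.
Proof.
apply: op_ind2 => [r s phi|r s t w IH].
  by rewrite /ev /= !mulrA al_comm.
rewrite !EDD (addrC (\sum_(b < r) _)).
apply: agreeD; first (apply: agreeD; last (apply: agreeN; apply: agreeD)).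
- exact: agreeM.
- by apply: agree_sum => b; apply: agreeM.
- by apply: agree_sum => b; apply: agreeM.
rewrite exchange_big; apply: agree_sum => b; apply: agree_sum => a /=.
by rewrite addnCA; apply: agreeM.
Qed.

Lemma vacD r c : endo_app (Dop r) (vac c) = vac (al r * c).
Proof.
apply: fock_eq => -[//|t w]; rewrite /ev /= (_ : contract _ _ = 0) // linear0 sub0r.
by rewrite big1 ?oppr0 // => a _; rewrite (_ : contract _ _ = 0) // linear0.
Qed.
Lemma vacE t c : endo_app (Eop t) (vac c) = 0.
Proof. exact: fock_eq. Qed.
Lemma vacH n c : endo_app (Hop n) (vac c) = vac (h n * c).
Proof. by apply: fock_eq => -[//|t w]; rewrite /ev /= /lscale mulr0. Qed.

Lemma EDF t r s : Eop t * (Dop r * Fop s) =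
  (Hop (s + t + m) * Dop r - \sum_(a < r) Hop (r - a.+1 + (s + t + m)) * Dop a)
  - (Dop r * Fop s * Eop t - \sum_(a < r) Dop a * Fop s * Eop (r - a.+1 + t)).
Proof.
rewrite mulrA ED mulrBl -(mulrA _ (Eop t)) EF mulrBr -HD mulrA.
rewrite mulr_suml [in RHS]subrACA; congr (_ - _).
rewrite -sumrB; apply: eq_bigr => a _.
rewrite -(mulrA _ (Eop _)) EF mulrBr -HD mulrA; congr (Hop _ * _ - _).
by rewrite addnCA !addnA.
Qed.

Lemma EFD t r s : Eop t * (Fop s * Dop r) = Hop (s + t + m) * Dop r
  - (Fop s * Dop r * Eop t - \sum_(a < r) Fop s * Dop a * Eop (r - a.+1 + t)).
Proof.
rewrite mulrA EF mulrBl -(mulrA _ (Eop t)) ED mulrBr mulrA; congr (_ - (_ - _)).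
by rewrite mulr_sumr; apply: eq_bigr => a _; rewrite mulrA.
Qed.

(** Both sides satisfy the same recursion under left multiplication by E t; for
    the right-hand side this needs the reflection of a double sum. *)
Lemma DF : forall r s, Dop r * Fop s =
  Fop s * Dop r - \sum_(a < r) Fop (r - a.+1 + s) * Dop a.
Proof.
pose G r s := Fop s * Dop r - \sum_(a < r) Fop (r - a.+1 + s) * Dop a.
apply: (op_ind2 (y := G)) => [r s phi|r s t w IH].
  by rewrite /G !endo_appE evD evN ev_sum /ev /= mulr0 big1 ?subr0.
have -> : Eop t * G r s =
  (Hop (s + t + m) * Dop r - \sum_(a < r) Hop (r - a.+1 + (s + t + m)) * Dop a)
  - (G r s * Eop t - \sum_(a < r) G a s * Eop (r - a.+1 + t)).
  rewrite /G mulrBr EFD mulr_sumr.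
  under [X in _ - X = _]eq_bigr => a _ do rewrite EFD.
  rewrite !sumrB [LHS]subrACA; congr (_ - _ - _).
    by apply: eq_bigr => a _; rewrite !addnA.
  rewrite [LHS]subrACA mulrBl mulr_suml; congr (_ - _).
  under [X in _ = X]eq_bigr => a _ do rewrite mulrBl mulr_suml.
  rewrite sumrB; congr (_ - _).
  exact: (sum_triangle_swap r
    (fun b i j => Fop (j + s)%N * Dop b * Eop (i + t)%N)).
rewrite EDF; apply: agreeD => //; apply: agreeN; apply: agreeD; first exact: agreeM.
by apply: agreeN; apply: agree_sum => a; apply: agreeM.
Qed.

Lemma FF r s : Fop r * Fop s = - (Fop s * Fop r).
Proof.
move: r s; apply: op_ind2 => [r s phi|r s t w IH].
  by rewrite endo_appN evN /ev /= oppr0.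
have EFF i j : Eop t * (Fop i * Fop j) =
    Hop (i + t + m) * Fop j - Hop (j + t + m) * Fop i + Fop i * Fop j * Eop t.
  rewrite mulrA EF mulrBl -(mulrA _ (Eop t)) EF mulrBr opprB addrA mulrA.
  by rewrite addrAC -HF.
rewrite mulrN !EFF opprD opprB -[- (_ * Eop t)]mulNr.
by apply: agreeD => //; apply: agreeM.
Qed.

(** The bracket of D k.+1 with E s is Qop s when D k.+1 vanishes, so that Qop s
    has to be zero; conversely, its vanishing yields that of D r for all r > k. *)
Definition Qop s := \sum_(a < k.+1) Dop a * Eop (k - a + s).
Definition Sop t s :=
  \sum_(a < k.+1) \sum_(b < a) Dop b * Eop (a - b.+1 + t) * Eop (k - a + s).

Lemma EQ t s : Eop t * Qop s = - (Qop s * Eop t) - Sop t s.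
Proof.
rewrite /Qop mulr_sumr mulr_suml -sumrN -sumrB; apply: eq_bigr => a _.
rewrite mulrA ED mulrBl mulr_suml; congr (_ - _).
by rewrite -!mulrA (EE t) mulrN.
Qed.

Lemma Sop_swap t s : Sop t s = - Sop s t.
Proof.
rewrite /Sop (sum_triangle_swap k.+1
  (fun b i j => Dop b * Eop (i + t)%N * Eop (j + s)%N)).
rewrite -sumrN; apply: eq_bigr => a _; rewrite -sumrN; apply: eq_bigr => b _.
by rewrite -!mulrA subSS EE mulrN.
Qed.

(** The sum over a telescopes.  Where the Q's vanish, Sop t s thus depends on t + s
    only, and as Sop_swap makes it antisymmetric it vanishes too. *)
Lemma Sop_shift t s : Sop t.+1 s - Sop t s.+1 = Qop t * Eop s + Qop s * Eop t.
Proof.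
rewrite /Sop (sum_triangle k.+1 (fun a b =>
  Dop b * Eop (a - b.+1 + t.+1)%N * Eop (k - a + s)%N)).
rewrite (sum_triangle k.+1 (fun a b =>
  Dop b * Eop (a - b.+1 + t)%N * Eop (k - a + s.+1)%N)).
rewrite /Qop !mulr_suml -sumrB -big_split; apply: eq_bigr => b _ /=.
have bk : (b <= k)%N by rewrite -ltnS.
rewrite -sumrB big_add1 /=.
pose g a := Dop b * Eop (a - b + t)%N * Eop (k - a + s)%N.
rewrite big_nat (eq_bigr (fun a => g a.+1 - g a)) => [|a /andP[ba ak]].
  rewrite -big_nat telescope_sumr // /g !subnn !add0n; congr (_ + _).
  by rewrite -!mulrA -mulrN -EE.
by rewrite /g; congr (Dop b * Eop _ * Eop _ - Dop b * Eop _ * Eop _); lia.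
Qed.

Lemma agree_Sop w t s : (forall j, agree w (Qop j) 0) -> agree w (Sop t s) 0.
Proof.
move=> Q0; have shift i j : agree w (Sop i.+1 j) (Sop i j.+1).
  move=> phi; apply/eqP; rewrite -subr_eq0 -evN -evD -endo_appN -endo_appD.
  by rewrite Sop_shift endo_appD evD !endo_appM !Q0 !endo_app0 /ev addr0.
have diag i j phi : ev w (endo_app (Sop i j) phi) =
    ev w (endo_app (Sop 0 (i + j)) phi).
  by elim: i j => // i IH j; rewrite shift IH addSnnS.
move=> phi; apply/eqP; have := diag s t phi; rewrite addnC -diag Sop_swap.
rewrite endo_appN evN => /eqP; rewrite eq_sym -subr_eq0 opprK -mulr2n -scaler_nat.
by rewrite scaler_eq0; have /eqP/negPf -> := char2.
Qed.

Lemma Qop0 s : Qop s = 0.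
Proof.
move: s; apply: (op_ind (y := fun=> 0)) => [s phi|s t w IH].
  rewrite endo_app_sum ev_sum; case/asboolP: (fock_valP phi) => _ R _.
  exact: (R [::]).
rewrite EQ mulr0; apply: agree0D; apply: agree0N; last exact: agree_Sop.
exact: agree0M.
Qed.

(** Moving E t to the right of D r leaves terms D a * E; those with a <= k add up
    to an operator Qop, and those with a > k vanish by induction. *)
Lemma Dop_large r : (forall r, (k < r)%N -> al r = 0) -> (k < r)%N -> Dop r = 0.
Proof.
move=> al0 kr; rewrite -(subnKC kr); move: (r - k.+1)%N => {kr}r.
move: r; apply: (op_ind (x := fun r => Dop (k.+1 + r)) (y := fun=> 0)) => [r phi|r t w IH].
  by rewrite /ev /= al0 ?mul0r // ltnS leq_addr.
rewrite ED mulr0; apply: agree0D; first exact: agree0M.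
apply: agree0N; rewrite big_split_ord /=.
rewrite (_ : \sum_(i < k.+1) _ = Qop (r + t)); last first.
  by apply: eq_bigr => a _; congr (_ * Eop _); have := ltn_ord a; lia.
rewrite Qop0 add0r; apply: agree0_sum => a; exact: agree0M.
Qed.

Definition dop (i : 'I_2) : nat -> End :=
  if i == top_row then Dop else conv Dop Hop.

Lemma fock_normal : al 0%N = 1 -> h 0%N = 1 ->
  (forall r, (k < r)%N -> al r = 0) ->
  normal_relations k m dop Eop Fop Hop.
Proof.
move=> al0 h0 al_large.
have D0 : Dop 0 = 1.
  apply: (op_ind (x := fun=> Dop 0) (y := fun=> 1) _ _ tt) => [[] phi|[] t w IH].
    by rewrite /ev /= al0 mul1r.
  by rewrite ED big_ord0 subr0 mulr1 -[X in agree _ _ X]mul1r; apply: agreeM (IH tt).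
have H0 : Hop 0 = 1 by apply: op_eq => phi w; rewrite /ev /= /lscale h0 mul1r.
have DE i r t : dop i r * Eop t =
    Eop t * dop i r + \sum_(a < r) dop i a * Eop (r - a.+1 + t)%N.
  have DE1 j : Dop j * Eop t =
      Eop t * Dop j + \sum_(a < j) Dop a * Eop (j - a.+1 + t)%N.
    by rewrite ED subrK.
  rewrite /dop; case: ifP => // _.
  rewrite mulr_suml mulr_sumr.
  under eq_bigr => a _ do rewrite -mulrA HE mulrA DE1 mulrDl -mulrA.
  rewrite big_split /=; congr (_ + _).
  under eq_bigr => a _ do rewrite mulr_suml.
  rewrite (eq_bigr (fun a : 'I_r.+1 => \sum_(b < a)
    Dop b * (Eop (a - b.+1 + t)%N * Hop (r.+1 - a.+1)%N))); last first.
    by move=> a _; apply: eq_bigr => b _; rewrite -mulrA.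
  rewrite (sum_triangle_swap r.+1 (fun b i j => Dop b * (Eop (i + t)%N * Hop j))).
  rewrite big_ord_recl big_ord0 add0r; apply: eq_bigr => a _.
  rewrite lift0 mulr_suml; apply: eq_bigr => b _.
  by rewrite !subSS -HE mulrA.
have DFi i r s : dop i r * Fop s =
    Fop s * dop i r - \sum_(a < r) Fop (r - a.+1 + s)%N * dop i a.
  rewrite /dop; case: ifP => [_|_]; first exact: DF.
  rewrite mulr_suml mulr_sumr.
  under eq_bigr => a _ do rewrite -mulrA HF mulrA DF mulrBl -mulrA.
  rewrite sumrB; congr (_ - _).
  under eq_bigr => a _ do rewrite mulr_suml.
  rewrite (eq_bigr (fun a : 'I_r.+1 => \sum_(b < a)
    Fop (a - b.+1 + s)%N * Dop b * Hop (r.+1 - a.+1)%N)); last by [].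
  rewrite (sum_triangle_swap r.+1 (fun b i j => Fop (i + s)%N * Dop b * Hop j)).
  rewrite big_ord_recl big_ord0 add0r; apply: eq_bigr => a _.
  rewrite lift0 mulr_sumr; apply: eq_bigr => b _.
  by rewrite !subSS mulrA.
split; first split.
- by move=> i; rewrite /dop; case: ifP => //; rewrite /conv big_ord1 D0 H0 mulr1.
- by move=> r kr; apply: Dop_large.
- have DC r n : Dop r * conv Dop Hop n = conv Dop Hop n * Dop r.
    rewrite mulr_suml mulr_sumr; apply: eq_bigr => a _.
    by rewrite mulrA DD -!mulrA HD.
  have CC r n : conv Dop Hop r * conv Dop Hop n = conv Dop Hop n * conv Dop Hop r.
    rewrite mulr_sumr [RHS]mulr_suml; apply: eq_bigr => a _.
    rewrite mulrA -DC -!mulrA; congr (_ * _).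
    rewrite mulr_suml mulr_sumr; apply: eq_bigr => b _.
    by rewrite [RHS]mulrA HD -!mulrA HH.
  by move=> i j r s; rewrite /dop; do 2!case: ifP => _; [apply: DD|apply: DC|symmetry; apply: DC|apply: CC].
- by split=> s t; [apply: EE|apply: FF].
- split=> [t s|n]; first by rewrite EF subrK.
  by rewrite /dop.
- by split.
Qed.

Lemma vac_dop r c :
  endo_app (dop bot_row r) (vac c) = vac (conv al h r * c).
Proof.
rewrite -[dop _ _]/(conv Dop Hop r) /conv endo_app_sum mulr_suml.
rewrite [LHS](eq_bigr (fun a : 'I_r.+1 => vac (al a * h (r - a)%N * c))); last first.
  by move=> a _; rewrite endo_appM vacH vacD mulrA.
have vacDD x y : vac (x + y) = vac x + vac y.
  by apply: fock_eq => -[|t w]; rewrite evD /ev /= ?addr0.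
have vac0 : vac 0 = 0 by apply: fock_eq; case.
by elim/big_rec2: _ => [|a y x _ ->]; rewrite ?vac0 ?vacDD.
Qed.

(** Contract along a longest word at which y does not vanish. *)
Lemma fock_to_vac y : y != 0 -> exists n (t : 'I_n -> nat) c,
  c != 0 /\ endo_app (\prod_(i < n) Eop (t i)) y = vac c.
Proof.
have [n by_n] : bounded (fock_val y) by case/asboolP: (fock_valP y).
elim: n y by_n => [|n IH] y by_n y0.
  by case/eqP: y0; apply: fock_eq => w; apply: by_n.
have [Ey|] := pselect (forall t, endo_app (Eop t) y = 0).
  exists 0%N, (fun=> 0%N), (ev [::] y); rewrite big_ord0 endo_app1.
  have yv : y = vac (ev [::] y).
    apply: fock_eq => -[//|t w]; rewrite -[LHS]/(ev w (endo_app (Eop t) y)) Ey.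
    by rewrite linear0.
  split=> //; apply: contra_neq y0 => yw; rewrite yv yw.
  by apply: fock_eq; case.
move=> /existsNP[t /eqP Ey]; have [w nw|n' [u [c [c0 e]]]] := IH _ _ Ey.
  exact: (by_n (t :: w)).
exists n'.+1, (fun i => if unlift ord_max i is Some j then u j else t), c.
split=> //; rewrite big_ord_recr endo_appM unlift_none -e.
congr (endo_app _ _); apply: eq_bigr => i _.
have -> : widen_ord (leqnSn n') i = lift ord_max i.
  by apply: val_inj; rewrite /= /bump leqNgt ltn_ord.
by rewrite liftK.
Qed.

Lemma vac_linear c x y : vac (c *: x + y) = c *: vac x + vac y.
Proof.
apply: fock_eq => -[|t w]; rewrite /ev /= lin_at //.
by rewrite /= scaler0 addr0.
Qed.

Lemma fock_representation : al 0%N = 1 -> h 0%N = 1 ->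
  (forall r, (k < r)%N -> al r = 0) ->
  exists (U : lmodType K) (nz : exists u : U, u != 0)
    (d : 'I_2 -> nat -> endo_space nz) (E F H : nat -> endo_space nz)
    (v : C -> U) (co : {linear U -> C}),
  normal_relations k m d E F H /\
  (linear v /\ forall c, co (v c) = c) /\
  (forall r c, endo_app (d top_row r) (v c) = v (al r * c)) /\
  (forall r c, endo_app (d bot_row r) (v c) = v (conv al h r * c)) /\
  (forall t c, endo_app (E t) (v c) = 0) /\
  (forall y, y != 0 -> exists n (t : 'I_n -> nat) c,
        c != 0 /\ endo_app (\prod_(i < n) E (t i)) y = v c).
Proof.
move=> al0 h0 al_large; exists fock, fock_nonzero, dop, Eop, Fop, Hop, vac, (ev [::]).
split; first exact: fock_normal.
split; first by split=> // c x y; apply: vac_linear.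
split; first exact: vacD.
split; first exact: vac_dop.
by split; [apply: vacE|apply: fock_to_vac].
Qed.

End Fock.

(** * Comparison with the Drinfeld presentation *)
Section Rescale.
Variables (K : fieldType) (B : algType K) (pi : pyramid) (p : 'I_2 -> bool).
Variable sigma : 'M[nat]_2.
Let s12 := sigma top_row bot_row.
Let s21 := sigma bot_row top_row.
Let k := pyr_k pi.
Let m := (s12 + s21).+1.
Let eps : K := (-1) ^+ p top_row.

Let epsM n : eps ^+ (n + n) = 1.
Proof. by rewrite addnn -mul2n exprM /eps sqrr_sign expr1n. Qed.

Lemma conv_scale (c : K) (x y : nat -> B) n :
  conv (fun r => c ^+ r *: x r) (fun r => c ^+ r *: y r) n = c ^+ n *: conv x y n.
Proof.
rewrite scaler_sumr; apply: eq_bigr => a _.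
by rewrite -scalerAl -scalerAr scalerA -exprD subnKC // -ltnS.
Qed.

(** Multiplying the generators by the powers of eps = (-1)^|1| given by their
    degree multiplies the terms of each relation by powers that differ by the sign
    occurring there, because eps^2 = 1. *)
Lemma normal_drinfeld (d : 'I_2 -> nat -> B) (E F h : nat -> B) :
  normal_relations k m d E F h ->
  drinfeld_relations pi p sigma (fun i r => eps ^+ r *: d i r)
    (fun r => eps ^+ (r - s12.+1) *: E (r - s12.+1)%N)
    (fun r => eps ^+ (r - s21.+1 + m.+1) *: F (r - s21.+1)%N).
Proof.
case=> -[d0 dk] dd [EE FF] [EF dh] [dE dF].
have d0' i : eps ^+ 0 *: d i 0%N = 1 by rewrite d0 scale1r.
split=> //; split=> [r kr|]; first by rewrite dk // scaler0.
split=> [i j r s _ _|].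
  by rewrite -!scalerAl -!scalerAr !scalerA dd mulrC subrr.
split=> [r s _ _|].
  by rewrite -!scalerAl -!scalerAr !scalerA EE mulrC scalerN addNr.
split=> [r s _ _|].
  by rewrite -!scalerAl -!scalerAr !scalerA FF mulrC scalerN addNr.
split.
  exists (conv_inverse (fun r => eps ^+ r *: d top_row r)).
  split=> [r|r s]; first by apply: (conv_inverseP (x := fun r => eps ^+ r *: d top_row r)).
  move=> /subnKC <- /subnKC <-; move: (r - _)%N (s - _)%N => t u.
  rewrite !addKn -!scalerAl -!scalerAr !scalerA [eps ^+ (u + _) * _]mulrC.
  rewrite -scalerDr EF.
  have -> : (s12.+1 + t + (s21.+1 + u) = (u + t + m).+1)%N by rewrite /m; lia.
  set n := (u + t + m)%N; rewrite subn1 /=.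
  rewrite (_ : \sum_(a < n.+1) _ = eps ^+ n *: h n).
    by rewrite scalerA -exprS -exprD; congr (eps ^+ _ *: _); rewrite /n; lia.
  transitivity (conv (conv_inverse (fun r => eps ^+ r *: d top_row r))
    (conv (fun r => eps ^+ r *: d top_row r) (fun r => eps ^+ r *: h r)) n).
    by apply: eq_bigr => a _; rewrite conv_scale dh.
  rewrite convA -[RHS](conv1 (fun r => eps ^+ r *: h r)); apply: eq_bigr => a _.
  by rewrite (conv_inverseP (x := fun r => eps ^+ r *: d top_row r)).
split=> i r s _.
  move=> /subnKC <-; move: (s - _)%N => t.
  rewrite addKn -!scalerAl -!scalerAr !scalerA [eps ^+ t * _]mulrC -scalerBr.
  rewrite dE addrAC subrr add0r !scaler_sumr; apply: eq_bigr => a _.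
  have -> : (r + (s12.+1 + t) - 1 - a = s12.+1 + (r - a.+1 + t))%N.
    by have := ltn_ord a; lia.
  rewrite addKn -scalerAl -scalerAr !scalerA -exprD -exprS -exprD.
  by congr (eps ^+ _ *: _); have := ltn_ord a; lia.
move=> /subnKC <-; move: (s - _)%N => t.
rewrite addKn -!scalerAl -!scalerAr !scalerA [eps ^+ (t + _) * _]mulrC -scalerBr.
rewrite dF addrAC subrr add0r scalerN !scaler_sumr; congr (- _).
apply: eq_bigr => a _.
have -> : (r + (s21.+1 + t) - 1 - a = s21.+1 + (r - a.+1 + t))%N.
  by have := ltn_ord a; lia.
rewrite addKn -scalerAl -scalerAr !scalerA -exprS -!exprD.
by congr (eps ^+ _ *: _); have := ltn_ord a; lia.
Qed.

Lemma drinfeld_normal (d : 'I_2 -> nat -> B) (e f : nat -> B) :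
  drinfeld_relations pi p sigma d e f ->
  exists h, normal_relations k m (fun i r => eps ^+ r *: d i r)
    (fun t => eps ^+ t *: e (s12.+1 + t)%N)
    (fun s => eps ^+ (s + m.+1) *: f (s21.+1 + s)%N) h.
Proof.
move=> [d0 [dk [dd [ee [ff [[dt [dtd ef]] [de df]]]]]]].
have dd' i j r s : d i r * d j s = d j s * d i r.
  case: r => [|r]; first by rewrite d0 mul1r mulr1.
  case: s => [|s]; first by rewrite d0 mul1r mulr1.
  by apply/eqP; rewrite -subr_eq0 dd.
exists (fun n => eps ^+ n *: conv dt (d bot_row) n).
have eqN (x y : B) : x + y = 0 -> x = - y by move=> /eqP; rewrite addr_eq0 => /eqP.
split.
- split=> [i|r kr]; first by rewrite d0 scale1r.
  by rewrite dk // scaler0.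
- by move=> i j r s; rewrite -!scalerAl -!scalerAr !scalerA dd' mulrC.
- split=> s t; rewrite -!scalerAl -!scalerAr !scalerA [X in X *: _]mulrC -scalerN;
    congr (_ *: _); apply: eqN.
    by apply: ee; rewrite addSn ltnS leq_addr.
  by apply: ff; rewrite addSn ltnS leq_addr.
- split=> [t s|n].
    rewrite -!scalerAl -!scalerAr !scalerA [eps ^+ (s + _) * _]mulrC -scalerDr.
    rewrite ef ?leq_addr // -/eps scalerA -exprD -exprSr.
    have -> : (s12.+1 + t + (s21.+1 + s) = (s + t + m).+1)%N by rewrite /m; lia.
    rewrite subn1 /= -/(conv dt (d bot_row) _).
    rewrite (_ : (t + (s + m.+1)).+1 = s + t + m + (1 + 1))%N; last by lia.
    by rewrite exprD epsM mulr1.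
  rewrite conv_scale convA; congr (_ *: _).
  rewrite -[RHS]conv1; apply: eq_bigr => a _; congr (_ * _).
  rewrite -(dtd a) convC // => i j; apply/esym.
  elim/ltn_ind: j => j IH.
  have -> : dt j = (j == 0%N)%:R - \sum_(b < j) dt b * d top_row (j - b)%N.
    by rewrite -(dtd j) big_ord_recr /= subnn d0 mulr1 addrAC subrr add0r.
  rewrite mulrBl mulrBr mulr_suml mulr_sumr commr_nat; congr (_ - _).
  by apply: eq_bigr => b _; rewrite mulrA -IH // -!mulrA dd'.
- split=> i r t.
    case: r => [|r]; first by rewrite big_ord0 addr0 d0 scale1r mul1r mulr1.
    apply/eqP; rewrite addrC -subr_eq; apply/eqP.
    rewrite -!scalerAl -!scalerAr !scalerA [eps ^+ t * _]mulrC -scalerBr.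
    rewrite de ?leq_addr // -/eps scalerA scaler_sumr; apply: eq_bigr => a _.
    have -> : (r.+1 + (s12.+1 + t) - 1 - a = s12.+1 + (r.+1 - a.+1 + t))%N.
      by have := ltn_ord a; lia.
    rewrite -scalerAl -scalerAr !scalerA -exprD -exprSr -exprD.
    rewrite (_ : (r.+1 + t).+1 =
      a + (r.+1 - a.+1 + t) + (1 + 1))%N; last by have := ltn_ord a; lia.
    by rewrite [in LHS]exprD epsM mulr1.
  case: r => [|r]; first by rewrite big_ord0 subr0 d0 scale1r mul1r mulr1.
  apply/eqP; rewrite addrC -subr_eq; apply/eqP.
  rewrite -!scalerAl -!scalerAr !scalerA [eps ^+ (t + _) * _]mulrC -scalerBr.
  rewrite df ?leq_addr // -/eps scalerN scalerA scaler_sumr; congr (- _).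
  apply: eq_bigr => a _.
  have -> : (r.+1 + (s21.+1 + t) - 1 - a = s21.+1 + (r.+1 - a.+1 + t))%N.
    by have := ltn_ord a; lia.
  rewrite -scalerAl -scalerAr !scalerA -exprD -exprSr -exprD.
  rewrite (_ : (r.+1 + (t + m.+1)).+1 =
    r.+1 - a.+1 + t + m.+1 + a + (1 + 1))%N; last by have := ltn_ord a; lia.
  by rewrite exprD epsM mulr1.
Qed.

End Rescale.

(** * Representations of the W-algebra on Fock modules *)
Lemma compatible_sum (pi : pyramid) (sigma : 'M[nat]_2) : compatible pi sigma ->
  (pyr_k pi + (sigma top_row bot_row + sigma bot_row top_row) = pyr_l pi)%N.
Proof.
move=> [_ [_]]; case: ifP => [_ [-> ->]|/negbT]; first by have := pyr_le pi; lia.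
by rewrite -leqNgt leqn0 => /eqP -> ->; rewrite add0n addnC.
Qed.

Section WalgRepresentation.
Variables (K : fieldType) (pi : pyramid) (p : 'I_2 -> bool) (sigma : 'M[nat]_2).
Hypothesis char2 : (2%:R : K) <> 0.
Hypothesis hsigma : compatible pi sigma.
Hypothesis hW : drinfeld_presentation K pi p sigma.
Let W := Walg K pi p.

(** The Fock module for the rescaled sequences al and h = al^-1 be satisfies the
    relations, and the universal property turns it into a representation. *)
Lemma Walg_representation (C : algType K) (al be : nat -> C) :
  (forall r s, al r * al s = al s * al r) ->
  (forall r s, al r * be s = be s * al r) ->
  (forall r s, be r * be s = be s * be r) ->
  al 0%N = 1 -> be 0%N = 1 ->
  (forall r, (pyr_k pi < r)%N -> al r = 0) ->
  (forall r, (pyr_l pi < r)%N -> be r = 0) ->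
  exists (U : lmodType K) (nz : exists u : U, u != 0)
    (phi : {lrmorphism W -> endo_space nz}) (v : C -> U) (co : {linear U -> C}),
  (linear v /\ forall c, co (v c) = c) /\
  (forall r c, endo_app (phi (d_gen K pi p top_row r)) (v c) = v (al r * c)) /\
  (forall r c, endo_app (phi (d_gen K pi p bot_row r)) (v c) = v (be r * c)) /\
  (forall r c, (sigma top_row bot_row < r)%N ->
        endo_app (phi (e_gen K pi p r)) (v c) = 0) /\
  (forall y, y != 0 -> exists w c, c != 0 /\ endo_app (phi w) y = v c).
Proof.
move=> aa ab bb a0 b0 a_large b_large.
pose eps : K := (-1) ^+ p top_row.
have eps2 n : eps ^+ n * eps ^+ n = 1.
  by rewrite -exprD addnn -mul2n exprM /eps sqrr_sign expr1n.
pose al' r := eps ^+ r *: al r; pose be' r := eps ^+ r *: be r.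
pose h := conv (conv_inverse al') be'.
have aa' r s : al' r * al' s = al' s * al' r.
  by rewrite -!scalerAl -!scalerAr !scalerA aa mulrC.
have ab' r s : al' r * be' s = be' s * al' r.
  by rewrite -!scalerAl -!scalerAr !scalerA ab mulrC.
have bb' r s : be' r * be' s = be' s * be' r.
  by rewrite -!scalerAl -!scalerAr !scalerA bb mulrC.
have a0' : al' 0%N = 1 by rewrite /al' a0 scale1r.
have comm_h c : (forall r, c * al' r = al' r * c) ->
    (forall r, c * be' r = be' r * c) -> forall n, c * h n = h n * c.
  move=> ca cb n; rewrite mulr_sumr mulr_suml; apply: eq_bigr => a _.
  by rewrite mulrA conv_inverse_comm // -!mulrA cb.
have ah r s : al' r * h s = h s * al' r by apply: comm_h.
have hh r s : h r * h s = h s * h r.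
  apply: (comm_h) => n; first by rewrite ah.
  by symmetry; apply: comm_h => i; rewrite ?ab'.
have conv_h n : conv al' h n = be' n.
  rewrite convA -[RHS]conv1; apply: eq_bigr => a _; congr (_ * _).
  rewrite convC ?conv_inverseP // => i j; exact: conv_inverse_comm.
have h0 : h 0%N = 1.
  by have := conv_h 0%N; rewrite /conv big_ord1 a0' mul1r subnn => ->; rewrite /be' b0 scale1r.
pose m := (sigma top_row bot_row + sigma bot_row top_row).+1.
have al_h n : (pyr_k pi + m <= n)%N ->
    \sum_(a < (pyr_k pi).+1) al' a * h (n - a)%N = 0.
  rewrite addnS (compatible_sum hsigma) => ln.
  have kn : (pyr_k pi < n.+1)%N by have := pyr_le pi; lia.
  rewrite (big_ord_widen n.+1 (fun a => al' a * h (n - a)%N)) // big_mkcond /=.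
  transitivity (conv al' h n); last by rewrite conv_h /be' b_large ?scaler0.
  apply: eq_bigr => a _; case: ifP => // /negbT; rewrite -leqNgt => ka.
  by rewrite /al' a_large ?scaler0 ?mul0r.
have al'_large r : (pyr_k pi < r)%N -> al' r = 0.
  by move=> kr; rewrite /al' a_large ?scaler0.
have [U [nz [d [E [F [H [v [co [normal [[vl cov] [dv1 [dv2 [Ev toV]]]]]]]]]]]]] :=
  fock_representation aa' ah hh al_h char2 a0' h0 al'_large.
have [_ [_ [_ [_ [[Wd0 _] univ]]]]] := hW.
have [phi [phid [phie phif]]] := univ _ _ _ _ (normal_drinfeld p normal).
have phid0 i r : phi (d_gen K pi p i r) = eps ^+ r *: d i r.
  case: r => [|r]; last exact: phid.
  by rewrite Wd0 rmorph1; have [[-> _] _ _ _ _] := normal; rewrite scale1r.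
have vZ a c : v (a *: c) = a *: v c.
  have := vl a c 0; rewrite addr0.
  by have := vl 1 0 0; rewrite !scale1r addr0 -[LHS]addr0 => /addrI <-; rewrite addr0.
exists U, nz, phi, v, co; split=> //; split; last split; last split.
- move=> r c; rewrite phid0 endo_appZ dv1 -vZ /al' -scalerAl scalerA eps2.
  by rewrite scale1r.
- move=> r c; rewrite phid0 endo_appZ dv2 conv_h -vZ /be' -scalerAl scalerA eps2.
  by rewrite scale1r.
- by move=> r c rs; rewrite phie // endo_appZ Ev scaler0.
- move=> y /toV[n [t [c [c0 e]]]].
  pose w : W := \prod_(i < n) (eps ^+ t i *: e_gen K pi p ((sigma top_row bot_row).+1 + t i)).
  exists w, c; split=> //; rewrite -e; congr (endo_app _ _).
  rewrite rmorph_prod; apply: eq_bigr => i _.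
  transitivity (eps ^+ t i *: phi (e_gen K pi p ((sigma top_row bot_row).+1 + t i))).
    exact: linearZ_LR.
  by rewrite phie ?leq_addr // addKn scalerA eps2 scale1r.
Qed.

End WalgRepresentation.

(** * Quotients and homomorphisms on subalgebras *)
Section Quotients.
Variables (W : pzRingType) (V : lmodType W) (N : submodule V).

Lemma quot_projZ a (v : V) : a *: quot_proj N v = quot_proj N (a *: v).
Proof. exact: quot_scaleE. Qed.

Lemma quot_proj_eq0 (v : V) : quot_proj N v = 0 <-> submod_pred N v.
Proof.
have -> : 0 = quot_proj N 0 by rewrite -(scale0r (0 : V)) -quot_projZ scale0r.
by rewrite quot_projE subr0.
Qed.

Lemma submod0 : submod_pred N 0.
Proof. exact: (submod_predP N).1. Qed.

Lemma submodZ a v : submod_pred N v -> submod_pred N (a *: v).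
Proof.
by move=> Nv; rewrite -[a *: v]addr0; apply: (submod_predP N).2 => //; apply: submod0.
Qed.

End Quotients.

(** Naming the action of the base field keeps it apart from the action of the
    algebra, whose scalars would otherwise be inferred in several ways. *)
Definition Kscale (K : fieldType) (W : algType K) (V : lmodType W) (a : K) (v : V) : V :=
  (a%:A : W) *: v.

Section HomOn.
Variables (K : fieldType) (A B : algType K) (G : A -> Prop).
Let S := gen_subalg G.

Lemma alg_hom_on_mono (P Q : A -> Prop) (f : A -> B) :
  (forall x, P x -> Q x) -> alg_hom_on Q f -> alg_hom_on P f.
Proof. by move=> PQ [f1 fh]; split=> // x y /PQ Qx /PQ Qy; apply: fh. Qed.

Variable f : A -> B.
Hypothesis fh : alg_hom_on S f.

Lemma gen_subalg1 : S 1.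
Proof. by rewrite -(scale1r 1); apply: gen_scal. Qed.

Lemma gen_subalg0 : S 0.
Proof. by rewrite -(scale0r 1); apply: gen_scal. Qed.

Lemma alg_hom_on0 : f 0 = 0.
Proof.
have [f1 fM] := fh; have [_ fl] := fM _ _ gen_subalg1 gen_subalg1.
by have := fl (-1); rewrite !scaleN1r !addNr.
Qed.

Lemma alg_hom_onD x y : S x -> S y -> f (x + y) = f x + f y.
Proof.
by move=> Sx Sy; have [_ /(_ 1)] := fh.2 _ _ Sx Sy; rewrite !scale1r.
Qed.

Lemma alg_hom_onM x y : S x -> S y -> f (x * y) = f x * f y.
Proof. by move=> Sx Sy; have [] := fh.2 _ _ Sx Sy. Qed.

Lemma alg_hom_on_scal a : f a%:A = a%:A.
Proof.
have [_ /(_ a)] := fh.2 _ _ gen_subalg1 gen_subalg0.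
by rewrite alg_hom_on0 fh.1 !addr0.
Qed.

Lemma alg_hom_on_ind (R : A -> B -> Prop) :
  (forall x, G x -> R x (f x)) ->
  (forall a, R a%:A a%:A) ->
  (forall x y x' y', R x x' -> R y y' -> R (x + y) (x' + y')) ->
  (forall x y x' y', R x x' -> R y y' -> R (x * y) (x' * y')) ->
  forall x, S x -> R x (f x).
Proof.
move=> RG Rs RD RM x; elim=> [y /RG //|c|y z Sy IHy Sz IHz|y z Sy IHy Sz IHz].
- by rewrite alg_hom_on_scal.
- by rewrite alg_hom_onD //; apply: RD.
- by rewrite alg_hom_onM //; apply: RM.
Qed.

End HomOn.

(** * The projection onto the Cartan subalgebra and the irreducible quotients *)
Section VermaModules.
Variables (K : fieldType) (pi : pyramid) (p : 'I_2 -> bool) (sigma : 'M[nat]_2).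
Hypothesis char2 : (2%:R : K) <> 0.
Hypothesis hsigma : compatible pi sigma.
Hypothesis hW : drinfeld_presentation K pi p sigma.
Notation W := (Walg K pi p).
Let k := pyr_k pi.
Let l := pyr_l pi.
Let s12 := sigma top_row bot_row.
Let d := d_gen K pi p.
Let e := e_gen K pi p.

Lemma Wsharp_W0 (x : W) : in_W0 x -> in_Wsharp sigma x.
Proof. by move=> x0; apply: gen_in; left. Qed.

Lemma Wsharp_e r : (s12 < r <= s12 + k)%N -> in_Wsharp sigma (e r).
Proof. by move=> sr; apply: gen_in; right; exists r. Qed.

(** W^sharp preserves the vacuum vectors, on which it acts by left multiplication
    by elements of C; this gives the homomorphism f. *)
Lemma Wsharp_hom (C : algType K) (al be : nat -> C) :
  (forall r s, al r * al s = al s * al r) ->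
  (forall r s, al r * be s = be s * al r) ->
  (forall r s, be r * be s = be s * be r) ->
  al 0%N = 1 -> be 0%N = 1 ->
  (forall r, (k < r)%N -> al r = 0) ->
  (forall r, (l < r)%N -> be r = 0) ->
  exists (U : lmodType K) (nz : exists u : U, u != 0)
    (phi : {lrmorphism W -> endo_space nz}) (v : C -> U) (f : W -> C),
  [/\ alg_hom_on (in_Wsharp sigma) f,
      forall r, (0 < r <= k)%N -> f (d top_row r) = al r,
      forall r, (0 < r <= l)%N -> f (d bot_row r) = be r,
      forall r, (s12 < r)%N -> f (e r) = 0
    & linear v /\ injective v /\
      (forall x c, in_Wsharp sigma x -> endo_app (phi x) (v c) = v (f x * c)) /\
      (forall y, y != 0 -> exists w c, c != 0 /\ endo_app (phi w) y = v c)].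
Proof.
move=> aa ab bb a0 b0 al_large be_large.
have [U [nz [phi [v [co [[vl cov] [d1 [d2 [ev toV]]]]]]]]] :=
  Walg_representation char2 hsigma hW aa ab bb a0 b0 al_large be_large.
pose f x := co (endo_app (phi x) (v 1)).
have v_inj : injective v by move=> x y /(congr1 co); rewrite !cov.
have v0 : v 0 = 0.
  by have := vl (-1) 0 0; rewrite scaler0 addr0 scaleN1r addNr.
have vD x y : v (x + y) = v x + v y by have := vl 1 x y; rewrite !scale1r.
have vZ a x : v (a *: x) = a *: v x by have := vl a x 0; rewrite v0 !addr0.
have phiZ a x : phi (a *: x) = a *: phi x by exact: linearZ_LR.
have ok x b : (forall c, endo_app (phi x) (v c) = v (b * c)) ->
    f x = b /\ forall c, endo_app (phi x) (v c) = v (f x * c).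
  by move=> xb; suff -> : f x = b by []; rewrite /f xb mulr1 cov.
have W0v x : in_W0 x -> forall c, endo_app (phi x) (v c) = v (f x * c).
  elim=> {x} [x [r _|r _]|a|x y _ IHx _ IHy|x y _ IHx _ IHy].
  - by have [] := ok _ _ (d1 r).
  - by have [] := ok _ _ (d2 r).
  - apply: (ok _ (a%:A) _).2 => c.
    by rewrite phiZ rmorph1 endo_appZ endo_app1 -scalerAl mul1r vZ.
  - apply: (ok _ (f x + f y) _).2 => c.
    by rewrite rmorphD endo_appD IHx IHy -vD mulrDl.
  - apply: (ok _ (f x * f y) _).2 => c.
    by rewrite rmorphM endo_appM IHy IHx mulrA.
have Wv x : in_Wsharp sigma x -> forall c, endo_app (phi x) (v c) = v (f x * c).
  elim=> {x} [x [/W0v //|[r /andP[sr _] ->]]|a|x y _ IHx _ IHy|x y _ IHx _ IHy].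
  - by apply: (ok _ 0 _).2 => c; rewrite ev // mul0r v0.
  - apply: (ok _ (a%:A) _).2 => c.
    by rewrite phiZ rmorph1 endo_appZ endo_app1 -scalerAl mul1r vZ.
  - apply: (ok _ (f x + f y) _).2 => c.
    by rewrite rmorphD endo_appD IHx IHy -vD mulrDl.
  - apply: (ok _ (f x * f y) _).2 => c.
    by rewrite rmorphM endo_appM IHy IHx mulrA.
exists U, nz, phi, v, f; split.
- split=> [|x y Sx Sy]; first by rewrite /f rmorph1 endo_app1 cov.
  split=> [|a]; first by rewrite /f rmorphM endo_appM !Wv // !cov !mulr1.
  have phiP : phi (a *: x + y) = a *: phi x + phi y by exact: linearP.
  by rewrite /f phiP endo_appD endo_appZ linearD linearZ.
- by move=> r _; rewrite /f d1 cov mulr1.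
- by move=> r _; rewrite /f d2 cov mulr1.
- by move=> r sr; rewrite /f ev // linear0.
by do !split=> //; move=> x c Sx; apply: Wv.
Qed.

(** Take C = W, with the generators of W^0 as coefficients: an element of W^0 then
    acts on the vacuum as multiplication by itself, so that f fixes W^0. *)
Lemma Wsharp_projP :
  Wsharp_proj_spec sigma (@Wsharp_proj K pi p sigma : W -> W).
Proof.
have [_ [_ [_ [_ [[d0 [dk [dd _]]] _]]]]] := hW.
have comm i j r s : d i r * d j s = d j s * d i r.
  case: r => [|r]; first by rewrite /d d0 mul1r mulr1.
  case: s => [|s]; first by rewrite /d d0 mul1r mulr1.
  by apply/eqP; rewrite -subr_eq0 /d dd.
pose be r := if (r <= l)%N then d bot_row r else 0.
have [|||||||U [nz [phi [v [f [fh f1 f2 fe _]]]]]] :=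
    @Wsharp_hom W (d top_row) be.
- by [].
- by move=> r s; rewrite /be; case: ifP; rewrite ?mulr0 ?mul0r.
- by move=> r s; rewrite /be; do 2!case: ifP => _; rewrite ?mulr0 ?mul0r.
- exact: d0.
- by rewrite /be /= /d d0.
- exact: dk.
- by move=> r lr; rewrite /be leqNgt lr.
have f0 x : in_W0 x -> f x = x.
  move=> x0; symmetry.
  apply: (alg_hom_on_ind (alg_hom_on_mono Wsharp_W0 fh) (R := fun x y => x = y)) x0.
  - by move=> _ [r rk|r rk]; rewrite ?f1 ?f2 // /be (andP rk).2.
  - by [].
  - by move=> x1 y1 x2 y2 -> ->.
  - by move=> x1 y1 x2 y2 -> ->.
apply: (xgetPex (id : W -> W) (P := [set g | Wsharp_proj_spec sigma g])).
exists f; split=> //; split=> //.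
move=> x; apply: (alg_hom_on_ind fh (R := fun x y => in_W0 y)).
- move=> y [y0|[r /andP[sr _] ->]]; first by rewrite f0.
  by rewrite fe //; apply: gen_subalg0.
- by move=> a; apply: gen_scal.
- by move=> _ _ y z; apply: gen_add.
- by move=> _ _ y z; apply: gen_mul.
Qed.


Lemma elem_sym0 n (a : n.-tuple K) : elem_sym a 0 = 1.
Proof.
by rewrite /elem_sym (big_pred1 finset.set0) ?finset.big_set0 // => S; rewrite cards_eq0.
Qed.

Lemma elem_sym_large n (a : n.-tuple K) r : (n < r)%N -> elem_sym a r = 0.
Proof.
move=> nr; rewrite /elem_sym big_pred0 // => S; apply/negbTE/eqP => Sr.
by have := max_card S; rewrite card_ord Sr leqNgt nr.
Qed.

(** The case C = K, where f restricts to the character of W^0 attached to A. *)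
Lemma tableau_representation (A : tableau K pi) :
  exists (U : lmodType K) (nz : exists u : U, u != 0)
    (phi : {lrmorphism W -> endo_space nz}) (v : K^o -> U) (f : W -> K^o),
  [/\ alg_hom_on (in_Wsharp sigma) f, W0_char_spec A f,
      forall r, (s12 < r)%N -> f (e r) = 0
    & linear v /\ injective v /\
      (forall x c, in_Wsharp sigma x -> endo_app (phi x) (v c) = v (f x * c)) /\
      (forall y, y != 0 -> exists w c, c != 0 /\ endo_app (phi w) y = v c)].
Proof.
have [|||||||U [nz [phi [v [f [fh f1 f2 fe rest]]]]]] :=
    @Wsharp_hom K^o (elem_sym A.1) (elem_sym A.2).
- by move=> r s; rewrite mulrC.
- by move=> r s; rewrite mulrC.
- by move=> r s; rewrite mulrC.
- exact: elem_sym0.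
- exact: elem_sym0.
- exact: elem_sym_large.
- exact: elem_sym_large.
exists U, nz, phi, v, f; split=> //; split=> //.
exact: alg_hom_on_mono Wsharp_W0 fh.
Qed.

Lemma W0_charP (A : tableau K pi) : W0_char_spec A (W0_char (p := p) A).
Proof.
have [U [nz [phi [v [f [_ f0 _ _]]]]]] := tableau_representation A.
by apply: (xgetPex (fun _ : W => 0 : K^o) (P := [set c | W0_char_spec A c])); exists f.
Qed.

Lemma Wsharp_charE (A : tableau K pi) (f : W -> K^o) :
  alg_hom_on (in_Wsharp sigma) f -> W0_char_spec A f ->
  (forall r, (s12 < r)%N -> f (e r) = 0) ->
  forall x, in_Wsharp sigma x -> Wsharp_char sigma A x = f x.
Proof.
move=> fh [f0h [f1 f2]] fe.
have [Ph [P0 [P1 Pe]]] := Wsharp_projP.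
have [ch [c1 c2]] := W0_charP A.
have cf x : in_W0 x -> W0_char A x = f x.
  move=> x0; symmetry.
  elim: x0 => {x} [x [r rk|r rk]|a|x y Sx IHx Sy IHy|x y Sx IHx Sy IHy].
  - by rewrite f1 // c1.
  - by rewrite f2 // c2.
  - by rewrite (alg_hom_on_scal f0h) (alg_hom_on_scal ch).
  - by rewrite (alg_hom_onD f0h) // (alg_hom_onD ch) // IHx IHy.
  - by rewrite (alg_hom_onM f0h) // (alg_hom_onM ch) // IHx IHy.
move=> x Sx; rewrite /Wsharp_char.
elim: Sx => {x} [x [x0|[r /andP[sr _] ->]]|a|x y Sx IHx Sy IHy|x y Sx IHx Sy IHy].
- by rewrite P1 // cf.
- by rewrite Pe // fe // (alg_hom_on0 ch).
- by rewrite (alg_hom_on_scal Ph) (alg_hom_on_scal ch) (alg_hom_on_scal fh).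
- rewrite (alg_hom_onD Ph) // (alg_hom_onD fh) // (alg_hom_onD ch) ?IHx ?IHy //;
    exact: P0.
- rewrite (alg_hom_onM Ph) // (alg_hom_onM fh) // (alg_hom_onM ch) ?IHx ?IHy //;
    exact: P0.
Qed.

(** The Verma module maps to the Fock module of A, sending its generator to the
    vacuum.  A nonzero vector of the image can be carried back to a multiple of
    the vacuum, so the quotient by the kernel is irreducible. *)
Lemma Lbar_irreducible (A : tableau K pi) : irreducible_mod (Lbar p sigma A).
Proof.
apply: (xgetPex (full_submod (verma p sigma A))
  (P := [set N | irreducible_mod (quot_mod N)])).
have [U [nz [phi [v [f [fh f0 fe [vl [v_inj [Sv toV]]]]]]]]] := tableau_representation A.
have v0 : v 0 = 0.
  by have := vl (-1) 0 0; rewrite scaler0 addr0 scaleN1r addNr.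
have vZ a x : v (a *: x) = a *: v x by have := vl a x 0; rewrite v0 !addr0.
have phiZ a x : phi (a *: x) = a *: phi x by exact: linearZ_LR.
pose act (w : W) := endo_app (phi w) (v 1).
have actD x y : act (x + y) = act x + act y by rewrite /act rmorphD.
have actM x y : act (x * y) = endo_app (phi x) (act y) by rewrite /act rmorphM.
have actB x y : act (x - y) = act x - act y by rewrite /act rmorphB.
have actZ a x : act (a *: x) = a *: act x by rewrite /act phiZ.
have act1 : act 1 = v 1 by rewrite /act rmorph1.
have rel0 (w : W) : submod_pred (verma_rel p sigma A) w -> act w = 0.
  move/asboolP; elim=> [|a u w' [x [y [Sy ->]]] _ IH].
    by rewrite /act rmorph0.
  rewrite actD IH addr0 [act _]actM.
  rewrite (_ : act _ = 0) ?linear0 // actB actZ actM [act y]Sv //.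
  by rewrite (Wsharp_charE fh f0 fe) // [v _](vZ (f y) 1) linearZ subrr.
pose q := quot_proj (verma_rel p sigma A).
have qD x y : q (x + y) = q x + q y by apply: quot_projD.
pose N y := `[< exists2 w : W, y = q w & act w = 0 >].
have Nq w : N (q w) <-> act w = 0.
  split=> [/asboolP[w' /quot_projE /rel0]|w0]; last by apply/asboolP; exists w.
  by rewrite actB => /subr0_eq ->.
have Nclosed : submod_closed (N : {pred verma p sigma A}).
  split=> [|a x y /asboolP[w -> w0] /asboolP[w' -> w'0]].
    rewrite -(scale0r (q 0)) quot_projZ; apply/Nq.
    by rewrite actM /act rmorph0.
  rewrite quot_projZ -qD; apply/Nq.
  by rewrite actD actM w0 w'0 addr0 linear0.
pose NN := Submodule Nclosed.
exists NN; split.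
  exists (quot_proj NN (q 1)); apply/eqP => /quot_proj_eq0 /Nq.
  rewrite act1 -v0 => /v_inj /eqP; apply/negP.
  exact: oner_neq0.
move=> S; have [S0|] := pselect (forall y, submod_pred S y -> y = 0); first by left.
move=> /existsNP[y /not_implyP[Sy y0]]; right.
have [z yz] := quot_proj_surj y; have [w zw] := quot_proj_surj z.
have /toV[w' [c [c0 wc]]] : act w != 0.
  apply/eqP => w0; apply: y0; rewrite yz zw; apply/quot_proj_eq0.
  by apply/Nq.
have S1 : submod_pred S (quot_proj NN (q 1)).
  rewrite (_ : quot_proj NN (q 1) = (c^-1 *: w') *: y); first exact: submodZ.
  rewrite yz zw !quot_projZ; apply/quot_projE.
  rewrite -[quot_proj _ 1 - _]/(q 1 - q (c^-1 *: w' * w)).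
  have -> : q 1 - q (c^-1 *: w' * w) = q (1 - c^-1 *: w' * w).
    by apply/eqP; rewrite subr_eq -qD subrK.
  apply/Nq; rewrite actB act1 actM phiZ endo_appZ wc -vZ.
  by rewrite -[_ *: c]/(c^-1 * c) mulVf // subrr.
move=> x; have [t ->] := quot_proj_surj x; have [r ->] := quot_proj_surj t.
rewrite (_ : quot_proj NN _ = r *: quot_proj NN (q 1)); first exact: submodZ.
by rewrite !quot_projZ -[r *: 1]/(r * 1) mulr1.
Qed.

Lemma Lbar_generator (A : tableau K pi) : exists v : Lbar p sigma A,
  [/\ v != 0, forall y, exists w : W, y = w *: v,
    forall r, (s12 < r <= s12 + k)%N -> e r *: v = 0,
    forall r, (0 < r <= k)%N -> d top_row r *: v = Kscale (W := W) (elem_sym A.1 r) v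
  & forall r, (0 < r <= l)%N -> d bot_row r *: v = Kscale (W := W) (elem_sym A.2 r) v].
Proof.
have [U [nz [phi [_ [f [fh f0 fe _]]]]]] := tableau_representation A.
pose q w : Lbar p sigma A :=
  quot_proj (verma_rad p sigma A) (quot_proj (verma_rel p sigma A) w).
pose v := q 1.
have vgen w : w *: v = q w.
  by rewrite /v /q !quot_projZ -[w *: 1]/(w * 1) mulr1.
have gen y : exists w : W, y = w *: v.
  have [t ->] := quot_proj_surj y; have [w ->] := quot_proj_surj t.
  by exists w; rewrite vgen.
have Sv x : in_Wsharp sigma x -> x *: v = Kscale (W := W) (f x : K) v.
  move=> Sx; rewrite /Kscale !vgen /q; congr (quot_proj _ _); apply/quot_projE.
  apply/asboolP; rewrite -[X in gen_submod _ X]addr0 -[X in X + 0]scale1r.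
  apply: gens_D; last exact: gens_0.
  by exists 1, x; split=> //; rewrite mul1r (Wsharp_charE fh f0 fe).
have [f0h [f1 f2]] := f0.
exists v; split.
- apply/eqP => v0; have [[y /eqP y0] _] := Lbar_irreducible A; apply: y0.
  by have [w ->] := gen y; rewrite v0 scaler0.
- exact: gen.
- move=> r sr; rewrite (Sv _ (Wsharp_e sr)) fe ?(andP sr).1 //.
  by rewrite /Kscale scale0r scale0r.
- move=> r rk; have Sd : in_Wsharp sigma (d top_row r).
    by apply: Wsharp_W0; apply: gen_in; constructor.
  by rewrite (Sv _ Sd) f1.
- move=> r rl; have Sd : in_Wsharp sigma (d bot_row r).
    by apply: Wsharp_W0; apply: gen_in; constructor.
  by rewrite (Sv _ Sd) f2.
Qed.

End VermaModules.

(** * Amitsur's eigenvector argument *)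
Lemma real_uncountable (R : realType) : ~ countable (setT : set R).
Proof.
move=> cR; have /(countable_lebesgue_measure0) : countable (`[0, 1]%classic : set R).
  by apply: sub_countable cR; apply: subset_card_le.
rewrite lebesgue_measure_itv /= lte_fin Num.Theory.ltr01 oppr0 adde0 => /eqP.
by rewrite eqe oner_eq0.
Qed.

(** Otherwise every fiber of nu would be finite, and the reals countable. *)
Lemma large_fiber (R : realType) (nu : R[i] -> nat) :
  exists n (s : seq R[i]), [/\ uniq s, size s = n.+1 & {in s, forall x, nu x = n}].
Proof.
apply: contrapT => none; apply: (@real_uncountable R).
have -> : (setT : set R) = (\bigcup_(n in setT) [set x : R | nu (x%:C)%C = n])%classic.
  by apply/seteqP; split=> // x _; exists (nu (x%:C)%C).
apply: bigcup_countable => // n _; apply: finite_set_countable; apply: contrapT.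
move=> /(infinite_set_fset n.+1)[B Bn sB]; apply: none.
pose s := [seq (x%:C)%C | x <- take n.+1 (finmap.enum_fset B)].
exists n, s; split.
- rewrite map_inj_uniq; first by rewrite take_uniq ?finmap.fset_uniq.
  by move=> x y [].
- by rewrite size_map size_takel.
- by move=> _ /mapP[x /mem_take xB ->]; apply: Bn.
Qed.

Section Amitsur.
Variables (K : closedFieldType) (V : lmodType K).
Hypothesis fibers : forall nu : K -> nat, exists n (s : seq K),
  [/\ uniq s, size s = n.+1 & {in s, forall x, nu x = n}].
Variable b : nat -> V.
Hypothesis b_span : forall x, exists n (c : 'I_n -> K), x = \sum_(i < n) c i *: b i.
Variables (T : {linear V -> V}) (S : V -> Prop).
Hypothesis S_closed : forall a x, S x -> S (T x - a *: x).

(** Choose y a with (T - a) (y a) = v.  By the hypothesis on fibers, n.+1 of the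
    y a lie in the span of n vectors, hence are dependent; multiplying a linear
    relation by the product of the T - a gives a nonzero polynomial p with
    p(T) v = 0, and one of the linear factors of p is not injective on S. *)
Lemma amitsur_eigenvector v : S v -> v != 0 ->
  (forall a, exists y, T y - a *: y = v) ->
  exists a w, [/\ S w, w != 0 & T w = a *: w].
Proof.
move=> Sv v0 /choice[y yP]; have nz : exists v : V, v != 0 by exists v.
have [nu nuP] := choice (fun a => b_span (y a)).
have [n [s [s_uniq s_size s_nu]]] := fibers nu.
have /choice[C CP] (j : 'I_n.+1) :
    exists c : 'I_n -> K, y s`_j = \sum_(i < n) c i *: b i.
  have js : s`_j \in s by rewrite mem_nth ?s_size.
  by have := nuP s`_j; rewrite (s_nu _ js).
pose M : 'M[K]_(n.+1, n) := \matrix_(j, i) C j i.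
have [u u0 uM] : exists2 u : 'rV_n.+1, u != 0 & u *m M = 0.
  have kM : kermx M != 0.
    by rewrite -mxrank_eq0 mxrank_ker subn_eq0 -ltnNge ltnS rank_leq_col.
  have [i ri0] : exists i, row i (kermx M) != 0.
    apply/existsP; apply: contraR kM => /existsPn ri; apply/eqP/row_matrixP => i.
    by rewrite row0; apply/eqP/negPn/ri.
  by exists (row i (kermx M)) => //; rewrite -row_mul mulmx_ker row0.
have dep : \sum_(j < n.+1) u 0 j *: y s`_j = 0.
  under eq_bigr => j _ do rewrite CP scaler_sumr.
  rewrite exchange_big big1 //= => i _.
  under eq_bigr => j _ do rewrite scalerA.
  have uC : \sum_(j < n.+1) u 0 j * C j i = 0.
    have uMi : (u *m M) 0 i = 0 by rewrite uM mxE.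
    rewrite mxE in uMi; rewrite -[RHS]uMi.
    by apply: eq_bigr => j _; rewrite mxE.
  by rewrite -scaler_suml uC scale0r.
pose t : endo_space nz := mk_endo nz T.
pose act (q : {poly K}) : endo_space nz := horner_alg t q.
have actM p q x : endo_app (act (p * q)) x = endo_app (act p) (endo_app (act q) x).
  by rewrite /act rmorphM.
have actL a x : endo_app (act ('X - a%:P)) x = T x - a *: x.
  by rewrite /act rmorphB /= horner_algX horner_algC.
have actZ a q x : endo_app (act (a *: q)) x = a *: endo_app (act q) x.
  by rewrite /act linearZ.
pose p := \sum_(j < n.+1) u 0 j *: \prod_(i < n.+1 | i != j) ('X - (s`_i)%:P).
have pv : endo_app (act p) v = 0.
  pose q := \prod_(i < n.+1) ('X - (s`_i)%:P).
  have -> : endo_app (act p) v = endo_app (act q) (\sum_(j < n.+1) u 0 j *: y s`_j).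
    rewrite /p {1}/act linear_sum endo_app_sum [RHS]linear_sum.
    apply: eq_bigr => j _; rewrite -/(act _) actZ linearZ; congr (_ *: _).
    have qE : q = \prod_(i < n.+1 | i != j) ('X - (s`_i)%:P) * ('X - (s`_j)%:P).
      by rewrite /q (bigD1 j) //= mulrC.
    by rewrite -[RHS]/(endo_app (act q) (y s`_j)) qE actM actL yP.
  by rewrite dep linear0.
have p0 : p != 0.
  have [j uj] : exists j, u 0 j != 0.
    apply/existsP; apply: contraR u0 => /existsPn uj; apply/eqP/rowP => j.
    by rewrite !mxE; apply/eqP/negPn/uj.
  apply/eqP => /(congr1 (fun q => q.[s`_j])); rewrite horner0 horner_sum.
  rewrite (bigD1 j) //= [X in _ + X]big1 => [|i ij]; last first.
    rewrite hornerZ horner_prod (bigD1 j) 1?eq_sym //=.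
    by rewrite hornerXsubC subrr mul0r mulr0.
  rewrite addr0 hornerZ horner_prod => /eqP; rewrite mulf_eq0 (negPf uj) /=.
  apply/negP/prodf_neq0 => i ij; rewrite hornerXsubC subr_eq0.
  by rewrite nth_uniq ?s_size // eq_sym.
have [r pr] := closed_field_poly_normal p.
have {pr}rv : endo_app (act (\prod_(z <- r) ('X - z%:P))) v = 0.
  have := pv; rewrite pr actZ => /eqP.
  by rewrite scaler_eq0 lead_coef_eq0 (negPf p0) => /eqP.
elim: r v Sv v0 rv {yP dep p pv p0} => [|z r IH] v Sv v0.
  by rewrite big_nil /act rmorph1 endo_app1 => v00; rewrite v00 eqxx in v0.
rewrite big_cons mulrC actM actL => rv.
have [Tz|Tz] := eqVneq (T v - z *: v) 0.
  by exists z, v; split=> //; apply/eqP; rewrite -subr_eq0 Tz.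
exact: IH (S_closed _ Sv) Tz rv.
Qed.

End Amitsur.

(** * Modules over the relations *)
Section ScalarRestriction.
Variables (K : fieldType) (W : algType K) (V : lmodType W).
Implicit Types (a b : K) (x y : V) (w : W).

Lemma KscaleC w a x : w *: Kscale a x = Kscale a (w *: x).
Proof. by rewrite /Kscale !scalerA mulr_algr mulr_algl. Qed.
Lemma KscaleZ a w x : (a *: w) *: x = Kscale a (w *: x).
Proof. by rewrite /Kscale scalerA mulr_algl. Qed.
Lemma KscaleA a b x : Kscale a (Kscale b x) = Kscale (a * b) x.
Proof. by rewrite /Kscale scalerA mulr_algl scalerA. Qed.
Lemma Kscale1 x : Kscale 1 x = x. Proof. by rewrite /Kscale !scale1r. Qed.
Lemma Kscale0 x : Kscale 0 x = 0. Proof. by rewrite /Kscale !scale0r. Qed.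
Lemma Kscaler0 a : Kscale a (0 : V) = 0. Proof. exact: scaler0. Qed.
Lemma KscaleDr a x y : Kscale a (x + y) = Kscale a x + Kscale a y.
Proof. exact: scalerDr. Qed.
Lemma KscaleDl x a b : Kscale (a + b) x = Kscale a x + Kscale b x.
Proof. by rewrite /Kscale !scalerDl. Qed.
Lemma KscaleN1 x : Kscale (-1) x = - x.
Proof. by rewrite /Kscale !scaleN1r. Qed.
Lemma Kscale_eq0 a x : Kscale a x = 0 -> x != 0 -> a = 0.
Proof.
move=> ax x0; apply/eqP; apply: contraNT x0 => a0; apply/eqP.
by rewrite -[x]Kscale1 -(mulVf a0) -KscaleA ax Kscaler0.
Qed.

Definition restriction : Type := V.
HB.instance Definition _ := GRing.Zmodule.on restriction.
HB.instance Definition _ := GRing.Zmodule_isLmodule.Build K restriction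
  KscaleA Kscale1 KscaleDr KscaleDl.

Definition action w (x : restriction) : restriction := w *: (x : V).
Lemma action_linear w : linear (action w).
Proof.
move=> a x y; rewrite /action -[LHS]/(w *: (Kscale a (x : V) + (y : V))).
by rewrite scalerDr KscaleC.
Qed.
HB.instance Definition _ w := GRing.isLinear.Build K restriction restriction _
  (action w) (action_linear w).

Lemma Kscale_inj x a b : x != 0 -> Kscale a x = Kscale b x -> a = b.
Proof.
move=> x0 /eqP; rewrite -subr_eq0 -KscaleN1 KscaleA -KscaleDl mulN1r => /eqP e.
by apply/eqP; rewrite -subr_eq0; apply/eqP/(Kscale_eq0 e x0).
Qed.

End ScalarRestriction.

Section Modules.
Variables (K : closedFieldType) (W : algType K) (k m : nat).
Variables (D : 'I_2 -> nat -> W) (E F h : nat -> W).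
Hypothesis fibers : forall nu : K -> nat, exists n (s : seq K),
  [/\ uniq s, size s = n.+1 & {in s, forall x, nu x = n}].
Hypothesis rel : normal_relations k m D E F h.
Hypothesis gen : forall w : W, gen_subalg (fun x =>
  [\/ exists i r, x = D i r, exists t, x = E t | exists s, x = F s]) w.

Let D0 i : D i 0%N = 1. Proof. by case: rel => -[]. Qed.
Let Dk r : (k < r)%N -> D top_row r = 0.
Proof. by case: rel => -[_ Dr] *; apply: Dr. Qed.
Let DD i j r s : D i r * D j s = D j s * D i r. Proof. by case: rel. Qed.
Let EE s t : E s * E t = - (E t * E s). Proof. by case: rel => _ _ []. Qed.
Let FF s t : F s * F t = - (F t * F s). Proof. by case: rel => _ _ []. Qed.
Let EF t s : E t * F s + F s * E t = h (s + t + m)%N.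
Proof. by case: rel => _ _ _ []. Qed.
Let Dh n : conv (D top_row) h n = D bot_row n.
Proof. by case: rel => _ _ _ []. Qed.
Let DE i r t : D i r * E t = E t * D i r + \sum_(a < r) D i a * E (r - a.+1 + t)%N.
Proof. by case: rel => _ _ _ _ []. Qed.
Let DF i r s : D i r * F s = F s * D i r - \sum_(a < r) F (r - a.+1 + s)%N * D i a.
Proof. by case: rel => _ _ _ _ []. Qed.

Hypothesis char2 : (2%:R : K) <> 0.

Let eq_opp0 (V : lmodType W) (x : V) : x = - x -> x = 0.
Proof.
move/eqP; rewrite -subr_eq0 opprK => /eqP xx.
have x2 : Kscale (1 + 1 : K) x = 0 by rewrite KscaleDl Kscale1.
apply/eqP; apply: contrapT => /negP x0; apply: char2.
exact: Kscale_eq0 x2 x0.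
Qed.

Section OneModule.
Variable V : lmodType W.
Implicit Types (x y z u v : V) (w : W).

Lemma stable_gen (P : V -> Prop) :
  (forall x y, P x -> P y -> P (x + y)) -> (forall a x, P x -> P (Kscale a x)) ->
  (forall i r x, P x -> P (D i r *: x)) -> (forall t x, P x -> P (E t *: x)) ->
  (forall s x, P x -> P (F s *: x)) -> forall w x, P x -> P (w *: x).
Proof.
move=> PD PZ PDi PE PF w; elim: (gen w) => {w}
  [_ [[i [r ->]]|[t ->]|[s ->]]|a|w1 w2 _ IH1 _ IH2|w1 w2 _ IH1 _ IH2] x Px.
- exact: PDi.
- exact: PE.
- exact: PF.
- exact: PZ.
- by rewrite scalerDl; apply: PD; [apply: IH1|apply: IH2].
- by rewrite -scalerA; apply: IH1; apply: IH2.
Qed.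

(** As in highest weight theory, the E's raise weights, the F's lower them and
    the D's form the Cartan subalgebra; Dspan, Fspan and Fimage below are built
    accordingly. *)
Definition singular x := forall t, E t *: x = 0.

Inductive Dspan u : V -> Prop :=
  | Dspan_self : Dspan u u
  | Dspan_add x y : Dspan u x -> Dspan u y -> Dspan u (x + y)
  | Dspan_scale a x : Dspan u x -> Dspan u (Kscale a x)
  | Dspan_D i r x : Dspan u x -> Dspan u (D i r *: x).

Inductive Fspan (S : V -> Prop) : V -> Prop :=
  | Fspan_in x : S x -> Fspan S x
  | Fspan_add x y : Fspan S x -> Fspan S y -> Fspan S (x + y)
  | Fspan_F s x : Fspan S x -> Fspan S (F s *: x).

Inductive Fimage : V -> Prop :=
  | Fimage0 : Fimage 0
  | Fimage_F s x : Fimage (F s *: x)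
  | Fimage_add x y : Fimage x -> Fimage y -> Fimage (x + y).

Lemma singular_add x y : singular x -> singular y -> singular (x + y).
Proof. by move=> sx sy t; rewrite scalerDr sx sy addr0. Qed.
Lemma singular_scale a x : singular x -> singular (Kscale a x).
Proof. by move=> sx t; rewrite KscaleC sx Kscaler0. Qed.
Lemma singular_sub x y : singular x -> singular y -> singular (x - y).
Proof. by move=> sx sy; rewrite -KscaleN1; apply/singular_add/singular_scale. Qed.

Lemma singular_D i r x : singular x -> singular (D i r *: x).
Proof.
move=> sx t; rewrite scalerA.
have -> : E t * D i r = D i r * E t - \sum_(a < r) D i a * E (r - a.+1 + t)%N.
  by rewrite DE addrK.
rewrite scalerBl -scalerA sx scaler0 scaler_suml big1 ?subr0 // => a _.
by rewrite -scalerA sx scaler0.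
Qed.

Lemma Dspan_singular u x : singular u -> Dspan u x -> singular x.
Proof.
move=> su; elim=> {x} [//|x y _ + _|a x _|i r x _].
- exact: singular_add.
- exact: singular_scale.
- exact: singular_D.
Qed.

(** As h = d_1^-1 d_2, its coefficients are polynomials in those of D. *)
Lemma h_stable (P : V -> Prop) :
  (forall x y, P x -> P y -> P (x + y)) -> (forall a x, P x -> P (Kscale a x)) ->
  (forall i r x, P x -> P (D i r *: x)) -> forall n x, P x -> P (h n *: x).
Proof.
move=> PD PZ PDi n; elim/ltn_ind: n => n IH x Px.
have P0 : P 0 by rewrite -(Kscale0 x); apply: (PZ).
have -> : h n = D bot_row n - \sum_(a < n) D top_row a.+1 * h (n - a.+1)%N.
  by rewrite -Dh /conv big_ord_recl D0 mul1r subn0 addrK.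
rewrite scalerBl -KscaleN1 scaler_suml; apply: (PD); first exact: PDi.
apply: (PZ); elim/big_ind: _ => // a _; rewrite -scalerA; apply/PDi/IH => //.
by have := ltn_ord a; lia.
Qed.

(** Triangular decomposition: D's and E's move to the right through the F's until
    they reach S, where D's act and E's vanish. *)
Lemma Fspan_stable (S : V -> Prop) :
  (forall x y, S x -> S y -> S (x + y)) -> (forall a x, S x -> S (Kscale a x)) ->
  (forall i r x, S x -> S (D i r *: x)) -> (forall x, S x -> singular x) ->
  forall w x, Fspan S x -> Fspan S (w *: x).
Proof.
move=> SD SZ SDi Ssing.
have FZ a x : Fspan S x -> Fspan S (Kscale a x).
  elim=> {x} [x Sx|x y _ IHx _ IHy|s x _ IHx].
  - exact/Fspan_in/SZ.
  - by rewrite KscaleDr; apply: Fspan_add.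
  - by rewrite -KscaleC; apply: Fspan_F.
have F0 x : Fspan S x -> Fspan S 0 by rewrite -(Kscale0 x); apply: FZ.
have FD i r x : Fspan S x -> Fspan S (D i r *: x).
  move=> Fx; elim: Fx i r => {x} [x Sx|x y _ IHx _ IHy|s x Fx IHx] i r.
  - exact/Fspan_in/SDi.
  - by rewrite scalerDr; apply: Fspan_add.
  - rewrite scalerA DF scalerBl -KscaleN1 -scalerA; apply: Fspan_add.
      exact/Fspan_F/IHx.
    apply: FZ; rewrite scaler_suml; elim/big_ind: _ => [|y z|a _].
    + exact: F0 Fx.
    + exact: Fspan_add.
    + by rewrite -scalerA; apply/Fspan_F/IHx.
apply: stable_gen => //; [exact: Fspan_add| |exact: Fspan_F].
move=> t x; elim=> {x} [x Sx|x y _ IHx _ IHy|s x Fx IHx].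
- by rewrite Ssing //; apply: F0 (Fspan_in Sx).
- by rewrite scalerDr; apply: Fspan_add.
- have -> : E t *: (F s *: x) = h (s + t + m)%N *: x - F s *: (E t *: x).
    by rewrite -EF scalerDl !scalerA addrK.
  rewrite -KscaleN1; apply: Fspan_add; last exact/FZ/Fspan_F.
  by apply: h_stable Fx => //; apply: Fspan_add.
Qed.

Lemma Fspan_split (S : V -> Prop) x : S 0 ->
  (forall x y, S x -> S y -> S (x + y)) -> Fspan S x ->
  exists y z, [/\ S y, Fimage z & x = y + z].
Proof.
move=> S0 SD; elim=> {x} [x Sx|_ _ _ [y [z [Sy Fz ->]]] _ [y' [z' [Sy' Fz' ->]]]|s x _ _].
- by exists x, 0; split; rewrite ?addr0 //; apply: Fimage0.
- exists (y + y'), (z + z'); split; last by rewrite addrACA.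
    exact: SD.
  exact: Fimage_add.
- by exists 0, (F s *: x); split; rewrite ?add0r //; apply: Fimage_F.
Qed.

Lemma Fimage_D i r x : Fimage x -> Fimage (D i r *: x).
Proof.
elim=> {x} [|s x|x y _ IHx _ IHy]; first by rewrite scaler0; apply: Fimage0.
  rewrite scalerA DF scalerBl -scaleNr; apply: Fimage_add.
    by rewrite -scalerA; apply: Fimage_F.
  rewrite -sumrN scaler_suml; elim/big_ind: _ => [|y z|a _].
  - exact: Fimage0.
  - exact: Fimage_add.
  - by rewrite -mulrN -scalerA; apply: Fimage_F.
by rewrite scalerDr; apply: Fimage_add.
Qed.

Lemma Fimage_scale a x : Fimage x -> Fimage (Kscale a x).
Proof.
elim=> {x} [|s x|x y _ IHx _ IHy]; first by rewrite Kscaler0; apply: Fimage0.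
  by rewrite -KscaleC; apply: Fimage_F.
by rewrite KscaleDr; apply: Fimage_add.
Qed.

(** The bracket of D k.+1 = 0 with F s. *)
Lemma F_reduce s : F (k + s)%N = - \sum_(a < k) F (k - a.+1 + s)%N * D top_row a.+1.
Proof.
apply/eqP; rewrite -addr_eq0; apply/eqP.
have := DF top_row k.+1 s; rewrite Dk // mul0r mulr0 sub0r => /eqP.
rewrite eq_sym oppr_eq0 big_ord_recl D0 mulr1 /= subSS subn0 => /eqP e0.
by rewrite -[RHS]e0; congr (_ + _); apply: eq_bigr => a _; rewrite subSS.
Qed.

Lemma DE_relation s : \sum_(a < k.+1) D top_row a * E (k - a + s)%N = 0.
Proof.
have := DE top_row k.+1 s; rewrite Dk // mul0r mulr0 add0r => e0.
by rewrite [RHS]e0; apply: eq_bigr => a _; rewrite subSS.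
Qed.

Lemma E_reduce s : E (k + s)%N = - \sum_(a < k) D top_row a.+1 * E (k - a.+1 + s)%N.
Proof.
apply/eqP; rewrite -addr_eq0; apply/eqP; rewrite -[RHS](DE_relation s).
by rewrite big_ord_recl D0 mul1r subn0.
Qed.

Definition Fpart n x := exists y : nat -> V, x = \sum_(t < n) F t *: y t.

Lemma Fpart_add n x y : Fpart n x -> Fpart n y -> Fpart n (x + y).
Proof.
move=> [x' ->] [y' ->]; exists (fun t => x' t + y' t).
by rewrite -big_split; apply: eq_bigr => t _; rewrite scalerDr.
Qed.

Lemma Fpart_F n s x : (s < n)%N -> Fpart n (F s *: x).
Proof.
move=> sn; exists (fun t => if t == s then x else 0).
rewrite (bigD1 (Ordinal sn)) //= eqxx big1 ?addr0 // => t ts.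
by rewrite ifN ?scaler0.
Qed.

Lemma Fpart0 n : Fpart n 0.
Proof. by exists (fun=> 0); rewrite big1 // => t _; rewrite scaler0. Qed.

Lemma Fimage_Fpart x : Fimage x -> Fpart k x.
Proof.
elim=> {x} [|s x|x y _ IHx _ IHy]; [exact: Fpart0| |exact: Fpart_add].
elim/ltn_ind: s x => s IH x; have [sk|ks] := ltnP s k; first exact: Fpart_F.
rewrite -(subnKC ks) F_reduce -sumrN scaler_suml.
elim/big_ind: _ => [|y z|a _]; [exact: Fpart0|exact: Fpart_add|].
by rewrite -mulrN -scalerA; apply: IH; have := ltn_ord a; lia.
Qed.

(** By F_reduce the F t with t < k have the same total image as all the F's.  These
    anticommute and square to zero: if V is the sum of the F t V for t <= n, then
    F n V is contained in the sum of the F t V for t < n, which is therefore V. *)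
Lemma Fimage_proper : (exists x, x != 0) -> exists x, ~ Fimage x.
Proof.
move=> [x /eqP x0]; apply: contrapT => /forallNP full.
have {full}full z : Fpart k z by apply: Fimage_Fpart; apply: contrapT; apply: full.
apply: x0; move: full; elim: k => [|n IH] full.
  by have [y ->] := full x; rewrite big_ord0.
have split z : exists y z', Fpart n y /\ z = y + F n *: z'.
  have [y ->] := full z; rewrite big_ord_recr /=.
  by exists (\sum_(t < n) F t *: y t), (y n); split=> //; exists y.
have FFn z : F n *: (F n *: z) = 0.
  by apply: eq_opp0; rewrite scalerA {1}FF scaleNr.
apply: IH => z; have [y [z' [Py ->]]] := split z.
have [_ [z'' [[u ->] ->]]] := split z'.
rewrite scalerDr FFn addr0; apply: Fpart_add => //.
exists (fun t => - (F n *: u t)); rewrite scaler_sumr; apply: eq_bigr => t _.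
by rewrite scalerA FF scaleNr scalerN scalerA.
Qed.

Lemma singular_small x : (forall t, (t < k)%N -> E t *: x = 0) -> singular x.
Proof.
move=> Ex; elim/ltn_ind => t IH; have [tk|kt] := ltnP t k; first exact: Ex.
rewrite -(subnKC kt) E_reduce scaleNr scaler_suml big1 ?oppr0 // => a _.
by rewrite -scalerA IH ?scaler0 //; have := ltn_ord a; lia.
Qed.

(** Apply in turn each E t with t < k that does not kill the vector obtained so
    far: anticommutation preserves what earlier E's killed. *)
Lemma singular_exists : (exists x, x != 0) -> exists2 x, x != 0 & singular x.
Proof.
move=> [x x0].
have [y y0 Ey] : exists2 y : V, y != 0 & forall t, (t < k)%N -> E t *: y = 0.
  elim: k => [|n [y y0 Ey]]; first by exists x.
  have [Eny|Eny] := eqVneq (E n *: y) 0.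
    by exists y => // t; rewrite ltnS leq_eqVlt => /predU1P[->//|]; apply: Ey.
  exists (E n *: y) => // t; rewrite ltnS leq_eqVlt => /predU1P[->|tn].
    by apply: eq_opp0; rewrite scalerA {1}EE scaleNr.
  by rewrite scalerA EE scaleNr -scalerA Ey // scaler0 oppr0.
by exists y => //; apply: singular_small.
Qed.

Hypothesis irr : irreducible_mod V.

Lemma irreducible_ind (P : V -> Prop) u : u != 0 -> P u ->
  (forall x y, P x -> P y -> P (x + y)) -> (forall w x, P x -> P (w *: x)) ->
  forall x, P x.
Proof.
move=> /eqP u0 Pu PD PZ; have P0 : P 0 by rewrite -(scale0r u); apply: PZ.
have Pc : submod_closed ((fun x => `[< P x >]) : {pred V}).
  split=> [|a x y /asboolP Px /asboolP Py]; apply/asboolP => //.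
  by apply: PD => //; apply: PZ.
have [N0|Nall] := irr.2 (Submodule Pc); last by move=> x; apply/asboolP/Nall.
by case: u0; apply: N0; apply/asboolP.
Qed.

Lemma Fspan_Dspan u : u != 0 -> singular u -> forall x, Fspan (Dspan u) x.
Proof.
move=> u0 su; apply: (irreducible_ind u0).
- exact/Fspan_in/Dspan_self.
- exact: Fspan_add.
- apply: Fspan_stable => [|a x|i r x|x].
  + exact: Dspan_add.
  + exact: Dspan_scale.
  + exact: Dspan_D.
  + exact: Dspan_singular.
Qed.

(** Otherwise z would generate V, and all of V would lie in Fimage. *)
Lemma singular_Fimage z : singular z -> Fimage z -> z = 0.
Proof.
move=> sz Fz; apply/eqP; apply: contrapT => /negP z0.
have [x []] := Fimage_proper irr.1; elim: (Fspan_Dspan z0 sz x) => {x} [x|x y _ + _|s x _ _].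
- elim=> {x} // [x y _ + _|a x _|i r x _].
  + exact: Fimage_add.
  + exact: Fimage_scale.
  + exact: Fimage_D.
- exact: Fimage_add.
- exact: Fimage_F.
Qed.

Lemma singular_Dspan u v : u != 0 -> singular u -> singular v -> Dspan u v.
Proof.
move=> u0 su sv; have [|y [z [Sy Fz vyz]]] := Fspan_split _ (@Dspan_add u) (Fspan_Dspan u0 su v).
  by rewrite -(Kscale0 u); apply/Dspan_scale/Dspan_self.
suff z0 : z = 0 by rewrite vyz z0 addr0.
apply: singular_Fimage => //; rewrite (_ : z = v - y); last by rewrite vyz addrC addKr.
exact: singular_sub sv (Dspan_singular su Sy).
Qed.

(** Words in the generators are coded by a countable type, to enumerate a spanning
    family of a cyclic module. *)
Let letter (l : 'I_2 * nat + (nat + nat)) : W :=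
  match l with inl ir => D ir.1 ir.2 | inr (inl t) => E t | inr (inr s) => F s end.
Let word (w : seq ('I_2 * nat + (nat + nat))) : W :=
  foldr (fun l (y : W) => letter l * y) 1 w.

Lemma countable_span v : v != 0 -> exists b : nat -> V, forall x,
  exists n (c : 'I_n -> K), x = \sum_(i < n) Kscale (c i) (b i).
Proof.
move=> v0; pose b n := if (unpickle n : option (seq ('I_2 * nat + (nat + nat)))) is Some w
  then word w *: v else 0.
exists b; pose P x := exists n (c : nat -> K), x = \sum_(i < n) Kscale (c i) (b i).
suff PV x : P x by move=> x; have [n [c ->]] := PV x; exists n, (fun i => c i).
have widen n N (c : nat -> K) : (n <= N)%N -> exists c' : nat -> K,
    \sum_(i < n) Kscale (c i) (b i) = \sum_(i < N) Kscale (c' i) (b i).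
  move=> nN; exists (fun i => if (i < n)%N then c i else 0).
  rewrite (big_ord_widen N (fun i => Kscale (c i) (b i)) nN) big_mkcond.
  by apply: eq_bigr => i _; case: ifP => //; rewrite Kscale0.
have PD y z : P y -> P z -> P (y + z).
  move=> [n [c ->]] [n' [c' ->]].
  have [c1 ->] := widen n (maxn n n') c (leq_maxl _ _).
  have [c2 ->] := widen n' (maxn n n') c' (leq_maxr _ _).
  exists (maxn n n'), (fun i => c1 i + c2 i); rewrite -big_split.
  by apply: eq_bigr => i _; rewrite KscaleDl.
have P0 : P 0 by exists 0%N, (fun=> 0); rewrite big_ord0.
have Pb j : P (b j).
  exists j.+1, (fun i => (i == j)%:R); rewrite big_ord_recr big1 /=.
    by rewrite eqxx Kscale1 add0r.
  by move=> i _; rewrite ltn_eqF // Kscale0.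
have PZ a y : P y -> P (Kscale a y).
  move=> [n [c ->]]; exists n, (fun i => a * c i).
  by rewrite /Kscale scaler_sumr; apply: eq_bigr => i _; apply: KscaleA.
have Pl l y : P y -> P (letter l *: y).
  move=> [n [c ->]]; rewrite scaler_sumr; elim/big_ind: _ => // i _.
  rewrite KscaleC; apply: PZ; rewrite /b; case: unpickle => [w|]; last by rewrite scaler0.
  by have := Pb (pickle (l :: w)); rewrite /b pickleK /= scalerA.
apply: (irreducible_ind v0) => //.
- by have := Pb (pickle ([::] : seq ('I_2 * nat + (nat + nat)))); rewrite /b pickleK scale1r.
- apply: stable_gen => // [i r y|t y|s y].
  + exact: (Pl (inl (i, r))).
  + exact: (Pl (inr (inl t))).
  + exact: (Pl (inr (inr s))).
Qed.

(** Suppose D i r has no singular eigenvector.  For each a, the nonzero singular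
    vector u = (D i r - a) v generates all singular vectors over the D's, so v is
    itself in the image of D i r - a; Amitsur's argument then gives an eigenvector.
    Its eigenspace is stable under the D's, hence contains all singular vectors. *)
Lemma D_scalar i r : exists a, forall x, singular x -> D i r *: x = Kscale a x.
Proof.
have [v v0 sv] := singular_exists irr.1.
have [a [z [sz z0 Dz]]] :
    exists a z, [/\ singular z, z != 0 & D i r *: z = Kscale a z].
  apply: contrapT => none; have [b b_span] := countable_span v0; apply: (none).
  pose T : {linear restriction V -> restriction V} := action (D i r).
  have T_closed a (x : restriction V) : singular (x : V) -> singular (T x - a *: x : V).
    by move=> sx; apply: singular_sub; [apply: singular_D|apply: singular_scale].
  suff T_onto a : exists y : restriction V, T y - a *: y = v.
    have [a [z [sz z0 Tz]]] :=
      amitsur_eigenvector (V := restriction V) fibers b_span T_closed sv v0 T_onto.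
    by exists a, z.
  pose u := D i r *: v - Kscale a v.
  have su : singular u by apply: singular_sub; [apply: singular_D|apply: singular_scale].
  have u0 : u != 0.
    by apply/eqP => /subr0_eq Dv; apply: none; exists a, v.
  elim: (singular_Dspan u0 su sv) => [|x y _ [x' <-] _ [y' <-]|c x _ [x' <-]|j s x _ [x' <-]].
  - by exists v.
  - by exists (x' + y'); rewrite linearD scalerDr opprD addrACA.
  - by exists (c *: x'); rewrite linearZ -[RHS]/(c *: (T x' - a *: x')) scalerBr !scalerA mulrC.
  - exists (D j s *: (x' : V)).
    change (D i r *: (D j s *: (x' : V)) - Kscale a (D j s *: (x' : V)) =
            D j s *: (D i r *: (x' : V) - Kscale a (x' : V))).
    by rewrite scalerBr KscaleC !scalerA DD.
exists a => x sx; elim: (singular_Dspan z0 sz sx) => {x sx} //.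
- by move=> x y _ IHx _ IHy; rewrite scalerDr IHx IHy KscaleDr.
- by move=> c x _ IHx; rewrite KscaleC IHx !KscaleA mulrC.
- by move=> j s x _ IHx; rewrite scalerA DD -scalerA IHx KscaleC.
Qed.

(** On a singular vector h n acts as E (n - m) (F 0 x), so that the convolution
    d_1 * h becomes an instance of DE_relation applied to F 0 x. *)
Lemma D_bot_large x r : singular x -> (k + m <= r)%N -> D bot_row r *: x = 0.
Proof.
move=> sx kmr; rewrite -Dh.
have hx n : (m <= n)%N -> h n *: x = E (n - m)%N *: (F 0 *: x).
  move=> mn; rewrite -[in LHS](subnK mn) -[(n - m)%N]add0n -EF add0n scalerDl.
  by rewrite -[X in _ + X]scalerA sx scaler0 addr0 scalerA.
have -> : conv (D top_row) h r *: x =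
    \sum_(a < k.+1) (D top_row a * E (k - a + (r - m - k))%N) *: (F 0 *: x).
  have kr : (k < r.+1)%N by lia.
  rewrite scaler_suml (big_ord_widen r.+1
    (fun a => (D top_row a * E (k - a + (r - m - k))%N) *: (F 0 *: x))) //.
  rewrite [RHS]big_mkcond; apply: eq_bigr => a _; case: ifP => [ak|/negbT ak]; last first.
    by rewrite Dk ?mul0r ?scale0r // ltnNge -ltnS ak.
  by rewrite -!scalerA hx; [congr (_ *: (E _ *: _))|]; lia.
by rewrite -scaler_suml DE_relation scale0r.
Qed.

(** With v singular, the monomials in F t, t < k, applied to v span V: on V each
    F s acts as a linear combination of these F t, since it does so on v and
    anticommutes with the F's. *)
Lemma irreducible_finite_dim : finite_dim_mod V.
Proof.
have [v v0 sv] := singular_exists irr.1.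
pose fd (P : V -> Prop) := exists n (b : 'I_n -> V), forall x, P x ->
  exists c : 'I_n -> K, x = \sum_(i < n) Kscale (c i) (b i).
(* Q n is the span of the 2^n monomials in the F t with t < n, applied to v. *)
pose Q := fix Q n x := if n is n'.+1
  then exists y z, [/\ Q n' y, Q n' z & x = y + F n' *: z]
  else exists a, x = Kscale a v.
have Q_fd n : fd (Q n).
  elim: n => [|n [N [b bP]]].
    exists 1%N, (fun=> v) => x [a ->]; exists (fun=> a); by rewrite big_ord1.
  exists (N + N)%N, (fun i : 'I_(N + N) => match fintype.split i with inl j => b j | inr j => F n *: b j end).
  move=> x [y [z [/bP[c ->] /bP[c' ->] ->]]].
  exists (fun i : 'I_(N + N) => match fintype.split i with inl j => c j | inr j => c' j end).
  rewrite big_split_ord scaler_sumr; congr (_ + _); apply: eq_bigr => i _.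
    by rewrite (unsplitK (inl i)).
  by rewrite (unsplitK (inr i)) KscaleC.
have Q0 n : Q n 0.
  elim: n => [|n IH]; first by exists 0; rewrite Kscale0.
  by exists 0, 0; rewrite scaler0 addr0.
have Q_add n x y : Q n x -> Q n y -> Q n (x + y).
  elim: n x y => [x y [a ->] [b ->]|n IH _ _ [x [x' [Qx Qx' ->]]] [y [y' [Qy Qy' ->]]]].
    by exists (a + b); rewrite KscaleDl.
  exists (x + y), (x' + y'); split; [exact: IH|exact: IH|].
  by rewrite scalerDr addrACA.
have Q_scale n a x : Q n x -> Q n (Kscale a x).
  elim: n x => [x [b ->]|n IH _ [x [x' [Qx Qx' ->]]]].
    by exists (a * b); rewrite KscaleA.
  exists (Kscale a x), (Kscale a x'); split; [exact: IH|exact: IH|].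
  by rewrite KscaleDr KscaleC.
have Q_widen n x : Q n x -> Q n.+1 x.
  by exists x, 0; rewrite scaler0 addr0.
have Q_F n t x : (t < n)%N -> Q n x -> Q n (F t *: x).
  elim: n x => // n IH x tn /= [y [z [Qy Qz ->]]].
  rewrite scalerDr; move: tn; rewrite ltnS leq_eqVlt => /predU1P[->|tn].
    have -> : F n *: (F n *: z) = 0 by apply: eq_opp0; rewrite scalerA {1}FF scaleNr.
    by exists 0, y; rewrite addr0 add0r.
  exists (F t *: y), (- (F t *: z)); split; [exact: IH| |].
    by rewrite -KscaleN1; apply/Q_scale/IH.
  by rewrite scalerA FF scaleNr scalerN scalerA.
have Qv n : Q n v.
  by elim: n => [|n IH]; [exists 1; rewrite Kscale1|apply: Q_widen].
pose S x := exists a, x = Kscale a v.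
have Fv s : exists c : nat -> K, F s *: v = \sum_(t < k) Kscale (c t) (F t *: v).
  elim/ltn_ind: s => s IH; have [sk|ks] := ltnP s k.
    exists (fun t => (t == s)%:R); rewrite (bigD1 (Ordinal sk)) //= eqxx Kscale1.
    rewrite big1 ?addr0 // => t ts.
    by rewrite (_ : (t == s :> nat) = false) ?Kscale0 //; apply: negbTE.
  have [chi chiP] := choice (fun r => D_scalar top_row r).
  pose good x := exists c : nat -> K, x = \sum_(t < k) Kscale (c t) (F t *: v).
  rewrite -(subnKC ks) F_reduce -sumrN scaler_suml.
  elim/big_ind: _ => [|x y [c ->] [c' ->]|a _].
  - by exists (fun=> 0); rewrite big1 // => t _; rewrite Kscale0.
  - exists (fun t => c t + c' t); rewrite -big_split.
    by apply: eq_bigr => t _; rewrite KscaleDl.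
  - rewrite scaleNr -scalerA chiP // KscaleC -KscaleN1 KscaleA.
    have [|c ->] := IH (k - a.+1 + (s - k))%N; first by have := ltn_ord a; lia.
    exists (fun t => (-1 * chi a.+1) * c t); rewrite /Kscale scaler_sumr.
    by apply: eq_bigr => t _; apply: KscaleA.
(* F s minus the combination with coefficients c kills v and anticommutes with
   every F r, so it kills V. *)
have FS s x (c : nat -> K) : F s *: v = \sum_(t < k) Kscale (c t) (F t *: v) ->
    Fspan S x -> F s *: x = \sum_(t < k) Kscale (c t) (F t *: x).
  move=> Fsv; elim=> {x} [x [a ->]|x y _ IHx _ IHy|r x _ IHx].
  - rewrite KscaleC Fsv /Kscale scaler_sumr; apply: eq_bigr => t _.
    by rewrite -!/(Kscale _ _) KscaleC !KscaleA mulrC.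
  - rewrite scalerDr IHx IHy -big_split; apply: eq_bigr => t _.
    by rewrite scalerDr KscaleDr.
  - rewrite scalerA FF scaleNr -scalerA IHx scaler_sumr -sumrN.
    apply: eq_bigr => t _; rewrite KscaleC (scalerA (F r) (F t)) FF scaleNr -(scalerA (F t)).
    by rewrite /Kscale scalerN opprK.
have QV x : Q k x.
  have Sx : Fspan S x.
    have S_add y z : S y -> S z -> S (y + z).
      by move=> [a ->] [b ->]; exists (a + b); rewrite KscaleDl.
    apply: (irreducible_ind v0).
    - by apply: Fspan_in; exists 1; rewrite Kscale1.
    - exact: Fspan_add.
    - apply: Fspan_stable => // [a y [b ->]|i r y [b ->]|y [b ->]].
      + by exists (a * b); rewrite KscaleA.
      + have [a ->] := D_scalar i r; first by exists (a * b); rewrite KscaleA.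
        exact: singular_scale.
      + exact: singular_scale.
  elim: Sx => {x} [x [a ->]|x y _ + _|s x Sx Qx].
  - exact: Q_scale.
  - exact: Q_add.
  - have [c Fsv] := Fv s; rewrite (FS _ _ _ Fsv Sx).
    by elim/big_ind: _ => // [|t _]; [exact: Q_add|apply/Q_scale/Q_F].
by have [n [b bP]] := Q_fd k; exists n, b => x; apply: bP.
Qed.

End OneModule.
Lemma Fimage_fst (V V' : lmodType W) (z : (V * V')%type) : Fimage z -> Fimage z.1.
Proof.
elim=> {z} [|s x|x y _ IHx _ IHy]; first exact: Fimage0.
  exact: (Fimage_F s x.1).
exact: (Fimage_add IHx IHy).
Qed.

Lemma Fimage_snd (V V' : lmodType W) (z : (V * V')%type) : Fimage z -> Fimage z.2.
Proof.
elim=> {z} [|s x|x y _ IHx _ IHy]; first exact: Fimage0.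
  exact: (Fimage_F s x.2).
exact: (Fimage_add IHx IHy).
Qed.

Definition weight_vector (V : lmodType W) (chi : 'I_2 -> nat -> K) (v : V) :=
  [/\ v != 0, singular v & forall i r, D i r *: v = Kscale (chi i r) v].

Lemma eq_weight_vector (V : lmodType W) chi chi' (v : V) :
  chi =2 chi' -> weight_vector chi v -> weight_vector chi' v.
Proof. by move=> eq_chi [v0 sv Dv]; split=> // i r; rewrite -eq_chi. Qed.

(** Compare v and v' through the pair (v, v') in V x V'.  If w kills v but not v',
    some multiple of w sends the pair to (0, v'); but that vector is a multiple
    c (v, v') modulo Fimage, where singular vectors vanish: the first component
    gives c = 0 and the second one then v' = 0. *)
Lemma weight_annihilator (V V' : lmodType W) chi (v : V) (v' : V') :
  irreducible_mod V -> irreducible_mod V' ->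
  weight_vector chi v -> weight_vector chi v' ->
  forall w, w *: v = 0 -> w *: v' = 0.
Proof.
move=> irr irr' [v0 sv Dv] [v'0 sv' Dv'] w wv.
apply/eqP; apply: contrapT => /negP wv'.
have [w2 w2P] : exists w2, w2 *: (w *: v') = v'.
  pose P y := exists w2, w2 *: (w *: v') = y.
  apply: (irreducible_ind (P := P) irr' wv').
  - by exists 1; rewrite scale1r.
  - by move=> _ _ [a <-] [b <-]; exists (a + b); rewrite scalerDl.
  - by move=> a _ [b <-]; exists (a * b); rewrite !scalerA !mulrA.
pose M : lmodType W := (V * V')%type.
pose u : M := (v, v').
pose S (x : M) := exists a, x = Kscale a u.
have S_add x y : S x -> S y -> S (x + y).
  by move=> [a ->] [b ->]; exists (a + b); rewrite KscaleDl.
have su : singular u.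
  by move=> t; rewrite -[LHS]/(E t *: v, E t *: v') sv sv'.
have Fu : Fspan S ((w2 * w) *: u).
  apply: Fspan_stable => //; last by apply: Fspan_in; exists 1; rewrite Kscale1.
  - by move=> a _ [b ->]; exists (a * b); rewrite KscaleA.
  - move=> i r _ [b ->]; exists (b * chi i r); rewrite KscaleC -KscaleA.
    by congr (Kscale _ _); rewrite -[LHS]/(D i r *: v, D i r *: v') Dv Dv'.
  - by move=> _ [b ->]; apply: singular_scale.
have [|_ [z [[c ->] Fz uz]]] := Fspan_split _ S_add Fu.
  by exists 0; rewrite Kscale0.
have uz1 : 0 = Kscale c v + z.1.
  by have := congr1 fst uz; rewrite -[LHS]/((w2 * w) *: v) -scalerA wv scaler0.
have uz2 : v' = Kscale c v' + z.2.
  by have := congr1 snd uz; rewrite -[LHS]/((w2 * w) *: v') -scalerA w2P.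
have c0 : c = 0.
  apply: (Kscale_eq0 _ v0); apply: (singular_Fimage irr).
    exact: singular_scale.
  rewrite (_ : Kscale c v = Kscale (-1) z.1); first exact/Fimage_scale/Fimage_fst.
  by apply/eqP; rewrite KscaleN1 -addr_eq0 -uz1.
move/eqP: v'0; apply; apply: (singular_Fimage irr') => //.
by rewrite uz2 c0 Kscale0 add0r; apply: Fimage_snd.
Qed.

Lemma weight_iso (V V' : lmodType W) chi (v : V) (v' : V') :
  irreducible_mod V -> irreducible_mod V' ->
  weight_vector chi v -> weight_vector chi v' -> iso_mod V V'.
Proof.
move=> irr irr' wv wv'.
have cyclic (U : lmodType W) (u : U) : irreducible_mod U -> u != 0 ->
    forall x, exists w, x = w *: u.
  move=> irrU u0; apply: (irreducible_ind (P := fun x => exists w, x = w *: u) irrU u0).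
  - by exists 1; rewrite scale1r.
  - by move=> _ _ [a ->] [b ->]; exists (a + b); rewrite scalerDl.
  - by move=> a _ [b ->]; exists (a * b); rewrite scalerA.
have [v0 _ _] := wv; have [v'0 _ _] := wv'.
have [g gP] := choice (cyclic V v irr v0).
have [g' g'P] := choice (cyclic V' v' irr' v'0).
pose f x := g x *: v'; pose f' x := g' x *: v.
have fE w : f (w *: v) = w *: v'.
  apply/eqP; rewrite -subr_eq0 -scalerBl; apply/eqP.
  apply: (weight_annihilator irr irr' wv wv').
  by rewrite scalerBl -gP subrr.
have f'E w : f' (w *: v') = w *: v.
  apply/eqP; rewrite -subr_eq0 -scalerBl; apply/eqP.
  apply: (weight_annihilator irr' irr wv' wv).
  by rewrite scalerBl -g'P subrr.
have f_linear : linear f.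
  move=> a x y; rewrite {1}(gP x) {1}(gP y) scalerA -scalerDl fE.
  by rewrite scalerDl -scalerA.
pose fL : {linear V -> V'} :=
  HB.pack f (GRing.isLinear.Build W V V' _ f f_linear).
exists fL; exists f' => x.
  by rewrite -[fL x]/(g x *: v') f'E -gP.
by rewrite -[fL _]/(f (g' x *: v)) fE -g'P.
Qed.

Lemma iso_weight (V V' : lmodType W) chi chi' (v : V) (v' : V') :
  irreducible_mod V' -> iso_mod V V' ->
  weight_vector chi v -> weight_vector chi' v' -> chi =2 chi'.
Proof.
move=> irr' [f [g fK _]] [v0 sv Dv] [v'0 sv' Dv'] i r.
have fv0 : f v != 0.
  by apply/eqP => fv; move/eqP: v0; apply; rewrite -(fK v) fv -(linear0 f) fK.
have sfv : singular (f v) by move=> t; rewrite -linearZ_LR sv linear0.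
have [c cP] := D_scalar irr' i r; transitivity c.
  by apply: (Kscale_inj fv0); rewrite -cP // -linearZ_LR Dv /Kscale linearZ_LR.
by apply: (Kscale_inj v'0); rewrite -cP // Dv'.
Qed.

End Modules.

(** * Tableaux and elementary symmetric functions *)
Section ElementarySymmetric.
Variable K : closedFieldType.

Lemma coef_prod_elem_sym n (a : n.-tuple K) j : (j <= n)%N ->
  (\prod_(x <- a) ('X - x%:P))`_j = (-1) ^+ (n - j) * elem_sym a (n - j).
Proof.
move=> jn; have := coef_prod_XsubC (ps := a) (n := j); rewrite size_tuple.
move=> /(_ jn) ->; congr (_ * _); rewrite /elem_sym.
by apply: eq_bigr => S _; apply: eq_bigr => i _; rewrite (tnth_nth 0).
Qed.

Lemma perm_elem_sym n (a b : n.-tuple K) :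
  perm_eq a b <-> elem_sym a =1 elem_sym b.
Proof.
have sgn r : (-1 : K) ^+ r != 0 by rewrite expf_neq0 // oppr_eq0 oner_eq0.
split=> [ab r|ab].
  have [rn|nr] := leqP r n; last by rewrite !elem_sym_large.
  have e : \prod_(x <- a) ('X - x%:P) = \prod_(x <- b) ('X - x%:P).
    exact: perm_big.
  have := congr1 (fun p : {poly K} => p`_(n - r)) e.
  by rewrite /= !coef_prod_elem_sym ?leq_subr // subKn // => /(mulfI (sgn r)).
apply: prod_XsubC_eq; apply/polyP => j; have [jn|nj] := leqP j n.
  by rewrite !coef_prod_elem_sym // ab.
by rewrite !nth_default // size_prod_XsubC size_tuple.
Qed.

Lemma elem_sym_surj n (c : nat -> K) : exists a : n.-tuple K,
  forall r, (0 < r <= n)%N -> elem_sym a r = c r.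
Proof.
pose q := 'X^n + \poly_(i < n) ((-1) ^+ (n - i) * c (n - i)%N).
have size_q : size q = n.+1.
  by rewrite size_polyDl size_polyXn // ltnS size_poly.
have lead_q : lead_coef q = 1.
  by rewrite lead_coefE size_q /= coefD coefXn eqxx coef_poly ltnn addr0.
have [s qs] := closed_field_poly_normal q.
rewrite lead_q scale1r in qs.
have size_s : size s == n by rewrite -eqSS -size_q qs size_prod_XsubC.
exists (Tuple size_s) => r /andP[r0 rn].
have sgn : (-1 : K) ^+ r != 0 by rewrite expf_neq0 // oppr_eq0 oner_eq0.
apply: (mulfI sgn); have := @coef_prod_elem_sym n (Tuple size_s) (n - r).
rewrite subKn // leq_subr => /(_ isT) <- /=; rewrite -qs coefD coefXn coef_poly.
by rewrite subKn // ltn_eqF ?add0r ?ifT //; lia.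
Qed.

End ElementarySymmetric.

(** * The classification *)
Section Classification.
Variables (R : realType) (pi : pyramid) (p : 'I_2 -> bool) (sigma : 'M[nat]_2).
Hypothesis hsigma : compatible pi sigma.
Hypothesis hW : drinfeld_presentation R[i] pi p sigma.
Notation K := (R[i] : closedFieldType).
Notation W := (Walg R[i] pi p).
Let k := pyr_k pi.
Let l := pyr_l pi.
Let s12 := sigma top_row bot_row.
Let s21 := sigma bot_row top_row.
Let m := (s12 + s21).+1.
Let eps : R[i] := (-1) ^+ p top_row.

Let D i r : W := eps ^+ r *: d_gen R[i] pi p i r.
Let E t : W := eps ^+ t *: e_gen R[i] pi p (s12.+1 + t)%N.
Let F s : W := eps ^+ (s + m.+1) *: f_gen R[i] pi p (s21.+1 + s)%N.

Let eps2 n : eps ^+ n * eps ^+ n = 1.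
Proof. by rewrite -exprD addnn -mul2n exprM /eps sqrr_sign expr1n. Qed.

Let char2 : (2%:R : R[i]) <> 0.
Proof. by apply/eqP; rewrite Num.Theory.pnatr_eq0. Qed.

Let rel : exists h, normal_relations k m D E F h.
Proof. by have [_ [_ [_ [_ [/drinfeld_normal]]]]] := hW. Qed.

Let gen (w : W) : gen_subalg (fun x =>
  [\/ exists i r, x = D i r, exists t, x = E t | exists s, x = F s]) w.
Proof.
have [_ [_ [_ [gen _]]]] := hW.
have scal n (x : W) G : gen_subalg G (eps ^+ n *: x) -> gen_subalg G x.
  move=> Gx; rewrite -[x]scale1r -(eps2 n) -scalerA -mulr_algl.
  by apply: gen_mul => //; apply: gen_scal.
elim: (gen w) => {w} [_ [i r _|r sr|r sr]|a|x y _ IHx _ IHy|x y _ IHx _ IHy].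
- by apply: (scal r); apply: gen_in; apply: Or31; exists i, r.
- apply: (scal (r - s12.+1)%N); apply: gen_in; apply: Or32.
  by exists (r - s12.+1)%N; rewrite /E subnKC.
- apply: (scal (r - s21.+1 + m.+1)%N); apply: gen_in; apply: Or33.
  by exists (r - s21.+1)%N; rewrite /F subnKC.
- exact: gen_scal.
- exact: gen_add.
- exact: gen_mul.
Qed.

(** The power of eps is that of the rescaled generators D i r. *)
Definition tab_weight (A : tableau R[i] pi) (i : 'I_2) (r : nat) : R[i] :=
  eps ^+ r * if i == top_row then elem_sym A.1 r else elem_sym A.2 r.

Lemma tab_weightP (V : lmodType W) (v : V) (A : tableau R[i] pi) :
  v != 0 -> singular E v ->
  (forall r, (0 < r <= k)%N -> D top_row r *: v = Kscale (W := W) (tab_weight A top_row r) v) ->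
  (forall r, (0 < r <= l)%N -> D bot_row r *: v = Kscale (W := W) (tab_weight A bot_row r) v) ->
  weight_vector D E (tab_weight A) v.
Proof.
move=> v0 sv D1 D2; split=> // i r; have [h hrel] := rel.
have [[D0 Dk] _ _ _ _] := hrel.
have [->|r0] := posnP r.
  by rewrite D0 scale1r /tab_weight mul1r !elem_sym0 if_same Kscale1.
have /orP[/eqP->|/eqP->] : (i == top_row) || (i == bot_row).
  by case: i => -[|[|]].
- have [rk|kr] := leqP r k; first by apply: D1; rewrite r0.
  by rewrite Dk // scale0r /tab_weight /= elem_sym_large // mulr0 Kscale0.
- have [rl|lr] := leqP r l; first by apply: D2; rewrite r0.
  rewrite (D_bot_large hrel) //; first by rewrite /tab_weight /= elem_sym_large // mulr0 Kscale0.
  by move: lr; rewrite /l -(compatible_sum hsigma) /m addnS.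
Qed.

Lemma irreducible_weight (V : lmodType W) : irreducible_mod V ->
  exists A (v : V), weight_vector D E (tab_weight A) v.
Proof.
move=> irr; have [h hrel] := rel.
have [v v0 sv] := singular_exists hrel char2 irr.1.
have Dscal := D_scalar (@large_fiber R) hrel gen char2 irr.
have [c1 c1P] := choice (Dscal top_row); have [c2 c2P] := choice (Dscal bot_row).
have [a aP] := elem_sym_surj k (fun r => eps ^+ r * c1 r).
have [b bP] := elem_sym_surj l (fun r => eps ^+ r * c2 r).
exists (a, b), v; apply: tab_weightP => // r rl.
  by rewrite c1P // /tab_weight /= aP // mulrA eps2 mul1r.
by rewrite c2P // /tab_weight /= bP // mulrA eps2 mul1r.
Qed.

Lemma irreducible_fin_dim (V : lmodType W) : irreducible_mod V -> finite_dim_mod V.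
Proof.
have [h hrel] := rel.
exact: (irreducible_finite_dim (@large_fiber R) hrel gen char2).
Qed.

Lemma generator_weight (V : lmodType W) (v : V) (A : tableau R[i] pi) :
  v != 0 ->
  (forall r, (s12 < r <= s12 + k)%N -> e_gen R[i] pi p r *: v = 0) ->
  (forall r, (0 < r <= k)%N ->
     d_gen R[i] pi p top_row r *: v = Kscale (W := W) (elem_sym A.1 r) v) ->
  (forall r, (0 < r <= l)%N ->
     d_gen R[i] pi p bot_row r *: v = Kscale (W := W) (elem_sym A.2 r) v) ->
  weight_vector D E (tab_weight A) v.
Proof.
have [h hrel] := rel; move=> v0 ve v1 v2.
apply: (tab_weightP v0) => [|r rk|r rl].
- apply: (singular_small hrel) => t tk.
  rewrite /E KscaleZ ve ?Kscaler0 //.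
  by rewrite addSn ltnS leq_addr /= -addnS leq_add2l.
- by rewrite /D KscaleZ (v1 r rk) KscaleA.
- by rewrite /D KscaleZ (v2 r rl) KscaleA.
Qed.

Lemma Lbar_weight (A : tableau R[i] pi) :
  exists v : Lbar p sigma A, weight_vector D E (tab_weight A) v.
Proof.
have [v [v0 _ ve v1 v2]] := Lbar_generator char2 hsigma hW A.
by exists v; apply: (generator_weight v0 ve v1 v2).
Qed.

Lemma weight_Lbar (V : lmodType W) (v : V) (A : tableau R[i] pi) : irreducible_mod V ->
  weight_vector D E (tab_weight A) v -> iso_mod V (Lbar p sigma A).
Proof.
move=> irr wv; have [u wu] := Lbar_weight A; have [h hrel] := rel.
exact: (weight_iso hrel gen char2 irr (Lbar_irreducible char2 hsigma hW A) wv wu).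
Qed.

Lemma row_equiv_weight (A B : tableau R[i] pi) : row_equiv A B <-> tab_weight A =2 tab_weight B.
Proof.
split=> [[/perm_elem_sym A1 /perm_elem_sym A2] i r|AB].
  by rewrite /tab_weight A1 A2.
have can r : injective ( *%R (eps ^+ r)).
  by move=> x y /(congr1 ( *%R (eps ^+ r))); rewrite !mulrA eps2 !mul1r.
split; apply/perm_elem_sym => r; apply: (can r).
  exact: (AB top_row).
exact: (AB bot_row).
Qed.

Lemma Lbar_iso (A B : tableau R[i] pi) :
  iso_mod (Lbar p sigma A) (Lbar p sigma B) <-> row_equiv A B.
Proof.
have [h hrel] := rel; have [v wv] := Lbar_weight A; have [u wu] := Lbar_weight B.
have irr := Lbar_irreducible char2 hsigma hW; split=> [AB|/row_equiv_weight AB].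
  apply/row_equiv_weight.
  exact: (iso_weight (@large_fiber R) hrel gen char2 (irr B) AB wv wu).
exact: (weight_Lbar (irr A) (eq_weight_vector AB wv)).
Qed.

End Classification.

Theorem theorem7p2 (R : realType) (pi : pyramid) (p : 'I_2 -> bool)
    (hp : p top_row != p bot_row) (sigma : 'M[nat]_2) (hsigma : compatible pi sigma)
    (hW : drinfeld_presentation R[i] pi p sigma) :
  (forall V : lmodType (Walg R[i] pi p), irreducible_mod V ->
     finite_dim_mod V /\
     exists A : tableau R[i] pi, iso_mod V (Lbar p sigma A)) /\
  (forall A B : tableau R[i] pi,
     iso_mod (Lbar p sigma A) (Lbar p sigma B) <-> row_equiv A B) /\
  (forall T : tableau R[i] pi -> Prop, row_representatives T ->
     (forall A, T A -> irreducible_mod (Lbar p sigma A)) /\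
     (forall A B, T A -> T B -> A <> B ->
        ~ iso_mod (Lbar p sigma A) (Lbar p sigma B)) /\
     (forall V : lmodType (Walg R[i] pi p), irreducible_mod V ->
        exists2 A, T A & iso_mod V (Lbar p sigma A))).
Proof.
have classify (V : lmodType (Walg R[i] pi p)) : irreducible_mod V ->
    exists A, forall B, row_equiv A B -> iso_mod V (Lbar p sigma B).
  move=> irr; have [A [v wv]] := irreducible_weight hsigma hW irr.
  exists A => B /(row_equiv_weight p) AB.
  exact: (weight_Lbar hsigma hW irr (eq_weight_vector AB wv)).
split.
  move=> V irr; split; first exact: (irreducible_fin_dim hW irr).
  by have [A VA] := classify V irr; exists A; apply: VA; split.
split; first exact: Lbar_iso.
move=> T [T_all T_inj]; split.
  by move=> A _; apply: Lbar_irreducible => //; apply/eqP; rewrite Num.Theory.pnatr_eq0.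
split=> [A B TA TB AB /(Lbar_iso hsigma hW) /(T_inj _ _ TA TB) //|V irr].
have [A VA] := classify V irr; have [B TB AB] := T_all A.
by exists B => //; apply: VA.
Qed.
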